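(* Let $\mathscr{A}$ be a unital $C^*$-algebra, $\mathscr{E}$ a Hilbert $\mathscr{A}$-module, $\mathscr{E}_1,\mathscr{E}_2$ ternary subspaces of $\mathscr{E}$, and let $z_0\in\mathscr{E}_1\cap\mathscr{E}_2$ be such that $\langle z_0,z_0\rangle=1$. Then $\mathscr{E}_1$ and $\mathscr{E}_2$ are module independent if and only if $$\|\langle x,z_0\rangle\langle y,z_0\rangle\|=\|\langle x,z_0\rangle\|\,\|\langle y,z_0\rangle\|\qquad(x\in\mathscr{E}_1,\ y\in\mathscr{E}_2).$$
   Context: A state on a $C^*$-algebra is a positive linear functional of norm one; $S(\mathscr{B})$ is the set of states of $\mathscr{B}$. Hilbert $C^*$-modules are right modules with $\mathscr{A}$-valued inner product $\langle\cdot,\cdot\rangle$, $\mathscr{A}$-linear in the second variable, and $\|x\|=\|\langle x,x\rangle\|^{1/2}$; for $x\in\mathscr{E}$, $|x|=\langle x,x\rangle^{1/2}\in\mathscr{A}$. For a closed subspace $\mathscr{F}\subseteq\mathscr{E}$, $\langle\mathscr{F},\mathscr{F}\rangle$ is the closed linear span of $\{\langle x,y\rangle:x,y\in\mathscr{F}\}$. A closed subspace $\mathscr{F}$ of $\mathscr{E}$ is ternary if $\mathscr{F}\langle\mathscr{F},\mathscr{F}\rangle\subseteq\mathscr{F}$; then $\langle\mathscr{F},\mathscr{F}\rangle$ is a $C^*$-subalgebra of $\mathscr{A}$. Ternary subspaces $\mathscr{E}_1,\mathscr{E}_2$ of $\mathscr{E}$ are (Hilbert $C^*$-)module independent if there are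 constants $m,M>0$ such that for all states $\varphi_i\in S(\langle\mathscr{E}_i,\mathscr{E}_i\rangle)$, $i=1,2$, there is a state $\varphi\in S(\mathscr{A})$ with $m\,\varphi_i(|x|)\le\varphi(|x|)\le M\,\varphi_i(|x|^2)^{1/2}$ for all $x\in\mathscr{E}_i$, $i=1,2$. *)

(* Defs.v *)
From HB Require Import structures.
From mathcomp Require Import all_boot all_order all_algebra.
From mathcomp Require Import all_classical all_reals all_analysis.
From mathcomp.real_closed Require Import complex.

Set Implicit Arguments.
Unset Strict Implicit.
Unset Printing Implicit Defensive.

Import Order.TTheory GRing.Theory Num.Theory.
Import numFieldNormedType.Exports.

Local Open Scope classical_set_scope.
Local Open Scope ring_scope.
Local Open Scope complex_scope.

(* Unital C*-algebras over the complex field R[i]: a Banach space with a product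
   [cmul], a unit [cone] and an involution [star]. The structure is built over
   CompleteNormedModule only, because Hierarchy-Builder accepts no join of ring
   and normed-module structures besides the existing numeric ones; the algType
   instance is recovered below, so that a * b and 1 denote [cmul a b] and [cone].
   Norms take their values in R[i], where x <= y means that y - x is a
   nonnegative real. *)
HB.mixin Record isCstarAlgebra (R : realType) A
    & CompleteNormedModule R[i] A := {
  cmul : A -> A -> A ;
  cone : A ;
  star : A -> A ;
  cmulA : associative cmul ;
  cmul1l : left_id cone cmul ;
  cmul1r : right_id cone cmul ;
  cmulDl : left_distributive cmul +%R ;
  cmulDr : right_distributive cmul +%R ;
  cone_neq0 : cone != 0 ;
  cmulZl : forall (c : R[i]) (a b : A), c *: cmul a b = cmul (c *: a) b ;
  cmulZr : forall (c : R[i]) (a b : A), c *: cmul a b = cmul a (c *: b) ;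
  starK : involutive star ;
  starD : forall a b : A, star (a + b) = star a + star b ;
  starZ : forall (c : R[i]) (a : A), star (c *: a) = c^*%R *: star a ;
  starM : forall a b : A, star (cmul a b) = cmul (star b) (star a) ;
  cstar_normM : forall a b : A, `|cmul a b| <= `|a| * `|b| ;
  cstar_normE : forall a : A, `|cmul (star a) a| = `|a| ^+ 2
}.

#[short(type="cstarAlgType")]
HB.structure Definition CstarAlgebra (R : realType) :=
  {A of CompleteNormedModule R[i] A & isCstarAlgebra R A}.

#[non_forgetful_inheritance]
HB.instance Definition _ (R : realType) (A : cstarAlgType R) :=
  GRing.Zmodule_isNzRing.Build (CstarAlgebra.sort A)
    cmulA cmul1l cmul1r cmulDl cmulDr cone_neq0.
#[non_forgetful_inheritance]
HB.instance Definition _ (R : realType) (A : cstarAlgType R) :=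
  GRing.Lmodule_isLalgebra.Build R[i] (CstarAlgebra.sort A) cmulZl.
#[non_forgetful_inheritance]
HB.instance Definition _ (R : realType) (A : cstarAlgType R) :=
  GRing.Lalgebra_isAlgebra.Build R[i] (CstarAlgebra.sort A) cmulZr.

Definition cstar_positive (R : realType) (A : cstarAlgType R) (a : A) : Prop :=
  exists b : A, a = star b * b.

(* The positive square root of a positive element a, i.e. the unique positive
   b with b^2 = a (the value is 0 when a is not positive). *)
Definition cstar_sqrt (R : realType) (A : cstarAlgType R) (a : A) : A :=
  xget 0 [set b | cstar_positive b /\ b ^+ 2 = a].

(* Right Hilbert modules over A. [ract x a] is x.a; [inner] is A-linear in its
   second variable. The norm of the underlying Banach space is required to be
   the one given by the inner product, which makes the latter definite. *)
HB.mixin Record isHilbertModule (R : realType) (A : cstarAlgType R) E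
    & CompleteNormedModule R[i] E := {
  ract : E -> A -> E ;
  inner : E -> E -> A ;
  ractDl : forall (x y : E) (a : A), ract (x + y) a = ract x a + ract y a ;
  ractDr : forall (x : E) (a b : A), ract x (a + b) = ract x a + ract x b ;
  ractM : forall (x : E) (a b : A), ract x (a * b) = ract (ract x a) b ;
  ract1 : forall x : E, ract x 1 = x ;
  ractZl : forall (c : R[i]) (x : E) (a : A), ract (c *: x) a = c *: ract x a ;
  ractZr : forall (c : R[i]) (x : E) (a : A), ract x (c *: a) = c *: ract x a ;
  innerDr : forall x y z : E, inner x (y + z) = inner x y + inner x z ;
  innerZr : forall (c : R[i]) (x y : E), inner x (c *: y) = c *: inner x y ;
  inner_ract : forall (x y : E) (a : A), inner x (ract y a) = inner x y * a ;
  inner_star : forall x y : E, star (inner x y) = inner y x ;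
  inner_positive : forall x : E, cstar_positive (inner x x) ;
  inner_normE : forall x : E, `|x| = sqrtC `|inner x x|
}.

#[short(type="hilbertModType")]
HB.structure Definition HilbertModule (R : realType) (A : cstarAlgType R) :=
  {E of CompleteNormedModule R[i] E & isHilbertModule R A E}.

Definition closed_subspace (R : realType) (V : normedModType R[i])
    (F : set V) : Prop :=
  submod_closed [in F] /\ closed F.

Definition closed_span (R : realType) (V : normedModType R[i])
    (S : set V) : set V :=
  smallest (@closed_subspace R V) S.

(* Functionals on a C*-subalgebra B of A are represented by functions on A of
   which only the restriction to B matters. *)
Definition functional_norm (R : realType) (A : cstarAlgType R)
    (B : set A) (f : A -> R[i]) : \bar R :=
  ereal_sup [set (complex.Re `|f a|)%:E | a in [set a | B a /\ `|a| <= 1]].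

Definition state_on (R : realType) (A : cstarAlgType R)
    (B : set A) (f : A -> R[i]) : Prop :=
  [/\ forall (c : R[i]) (a b : A), B a -> B b -> f (c *: a + b) = c * f a + f b,
      forall a : A, B a -> 0 <= f (star a * a)
    & functional_norm B f = 1%:E].

Section Ternary.
Variables (R : realType) (A : cstarAlgType R) (E : hilbertModType A).

Definition modulus (x : E) : A := cstar_sqrt (inner x x).

Definition inner_span (F : set E) : set A :=
  closed_span [set inner p.1 p.2 | p in F `*` F].

Definition ternary_subspace (F : set E) : Prop :=
  closed_subspace F /\
  forall (x : E) (a : A), F x -> inner_span F a -> F (ract x a).

Definition module_independent (E1 E2 : set E) : Prop :=
  exists m M : R, [/\ 0 < m, 0 < M &
    forall phi1 phi2 : A -> R[i],
      state_on (inner_span E1) phi1 -> state_on (inner_span E2) phi2 ->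
      exists phi : A -> R[i],
        [/\ state_on setT phi,
            forall x : E, E1 x ->
              m%:C * phi1 (modulus x) <= phi (modulus x)
                <= M%:C * sqrtC (phi1 (modulus x ^+ 2))
          & forall x : E, E2 x ->
              m%:C * phi2 (modulus x) <= phi (modulus x)
                <= M%:C * sqrtC (phi2 (modulus x ^+ 2))]].

End Ternary.

(* Main.v *)
(* Since <z0, z0> = 1, the algebras B_i = <E_i, E_i> are unital, x |-> <x, z0>
   maps E_i onto B_i, and |z0.b| = b for b >= 0 in B_i; so both conditions are
   statements about the pair B_1, B_2.

   If E_1, E_2 are independent and a in B_1, b in B_2 have norm 1, take states
   with phi_1(p) = phi_2(q) = 1 for p = a^* a and q = b b^*. Then
   phi_1((1 - p)^2) = 0, so the upper bound gives phi(1 - p) = 0 and likewise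
   phi(1 - q) = 0; hence phi(p q) = 1 and |a b| >= |p q| >= 1.

   Conversely, multiplicativity of the norm yields, for nonzero a >= 0 in B_1
   and b >= 0 in B_2, a state psi of A with psi(a) = |a| and psi(b) = |b|. Hence
   a + b |-> phi_1(a) + phi_2(b) is dominated on B_1 + B_2 by the spectral
   maximum of the self-adjoint part, and Hahn-Banach provides a common extension
   phi of phi_1 and phi_2; m = M = 1 then works by Cauchy-Schwarz. *)
From HB Require Import structures.
Require Import Defs.
From mathcomp Require Import all_boot all_order all_algebra.
From mathcomp Require Import all_classical all_reals all_analysis.
From mathcomp.real_closed Require Import complex.
From mathcomp Require Import ring lra.

Set Implicit Arguments.
Unset Strict Implicit.
Unset Printing Implicit Defensive.

Import Order.TTheory GRing.Theory Num.Theory.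
Import numFieldNormedType.Exports.

Local Open Scope classical_set_scope.
Local Open Scope ring_scope.
Local Open Scope complex_scope.

(** * Involution and norm in a C*-algebra *)

Section CstarBasics.
Variables (R : realType) (A : cstarAlgType R).
Implicit Types (a b x y : A) (c t : R[i]).

Lemma cstarM a b : star (a * b) = star b * star a.
Proof. exact: starM. Qed.

Lemma cstar_normMle a b : `|a * b| <= `|a| * `|b|.
Proof. exact: cstar_normM. Qed.

Lemma cstar_normC a : `|star a * a| = `|a| ^+ 2.
Proof. exact: cstar_normE. Qed.

Lemma cstar0 : star 0 = 0 :> A.
Proof. by apply: (addrI (star 0)); rewrite -starD !addr0. Qed.

Lemma cstarN a : star (- a) = - star a.
Proof. by apply: (addrI (star a)); rewrite -starD !subrr cstar0. Qed.

Lemma cstarB a b : star (a - b) = star a - star b.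
Proof. by rewrite starD cstarN. Qed.

Lemma cstar1 : star 1 = 1 :> A.
Proof. by rewrite -[LHS]mulr1 -{2}[1](starK (1 : A)) -cstarM mulr1 starK. Qed.

Lemma cstar_norm1 : `|1 : A| = 1.
Proof.
have := cstar_normC 1; rewrite cstar1 mulr1 expr2 => /eqP.
rewrite -subr_eq0 -{1}[`|1 : A|]mulr1 -mulrBr mulf_eq0 normr_eq0 oner_eq0 /=.
by rewrite subr_eq0 => /eqP.
Qed.

(** From [|b|^2 = |star b * b| <= |star b| |b|] one inequality follows; the other is the same one at
    [star b]. *)
Lemma cstar_norm_star a : `|star a| = `|a|.
Proof.
suff le b : `|b| <= `|star b|.
  by apply/eqP; rewrite eq_le le -{2}(starK a) le.
have [->|b0] := eqVneq b 0; first by rewrite cstar0.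
rewrite -(ler_pM2r (x := `|b|)) ?normr_gt0// -expr2 -cstar_normC.
exact: cstar_normMle.
Qed.

Lemma cstar_sq_eq0 a : star a = a -> a * a = 0 -> a = 0.
Proof.
move=> sa aa; apply/eqP; rewrite -normr_eq0 -sqrf_eq0 -cstar_normC sa aa.
by rewrite normr0.
Qed.

End CstarBasics.

(** * Square roots by successive approximation *)

Section ClosedSets.
Variables (R : realType) (V : normedModType R[i]).

Lemma norm_real_complex (x : V) : {r : R | 0 <= r & `|x| = r%:C}.
Proof.
exists (complex.Re `|x|); last by rewrite RRe_real.
by rewrite -lecR RRe_real ?normr_real // (_ : 0%:C = 0).
Qed.

(** A positive radius in [R[i]] is real, so approximation to within real [e] suffices. *)
Lemma closed_approx (U : set V) (x : V) :
  closed U -> (forall e : R, 0 < e -> exists2 y, U y & `|x - y| < e%:C) -> U x.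
Proof.
move=> cU h; apply: cU => B /nbhs_ballP[e /= e0 eB].
have /complex_realP[r er] := gtr0_real e0.
rewrite er in e0 eB.
have [|y Uy xy] := h r; first by rewrite -ltcR.
by exists y; split=> //; apply: eB; rewrite -ball_normE.
Qed.

Lemma approx_closed (U : set V) :
  (forall x, (forall e : R, 0 < e -> exists2 y, U y & `|x - y| < e%:C) -> U x)
    ->
  closed U.
Proof.
move=> h x xU; apply: h => e e0.
have [|y [Uy xy]] := xU (ball x e%:C).
  by apply: nbhsx_ballx; rewrite (ltcR 0).
by exists y => //; move: xy; rewrite -ball_normE.
Qed.

Lemma norm_approx_eq0 (x : V) :
  (forall e : R, 0 < e -> `|x| <= e%:C) -> x = 0.
Proof.
have [r r0 xr] := norm_real_complex x; move=> h.
apply/eqP; rewrite -normr_eq0 xr; apply/eqP; congr (_%:C).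
apply/le_anti; rewrite r0 andbT; apply/ler_addgt0Pl => e e0; rewrite addr0.
by rewrite -lecR -xr h.
Qed.

End ClosedSets.

(** Asking only for additivity and a Lipschitz bound covers [star x - x], which is not
    complex-linear. *)
Lemma closed_kernel (R : realType) (V W : normedModType R[i]) (f : V -> W)
    (K : R) :
  {morph f : x y / x - y} -> (forall x, `|f x| <= K%:C * `|x|) ->
  closed [set x | f x = 0].
Proof.
move=> fB fK; apply: approx_closed => x h /=.
apply: norm_approx_eq0 => e e0.
have [|y /= fy xy] := h (e / (`|K| + 1)).
  by rewrite divr_gt0// ltr_wpDl.
rewrite -[f x]subr0 -fy -fB; apply: (le_trans (fK _)).
apply: (@le_trans _ _ (`|K|%:C * (e / (`|K| + 1))%:C)).
  apply: (@le_trans _ _ (`|K|%:C * `|x - y|)).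
    by rewrite ler_wpM2r// lecR ler_norm.
  by rewrite ler_wpM2l ?(lecR 0)// ltW.
rewrite -rmorphM lecR mulrCA ger_pMr// ler_pdivrMr ?ltr_wpDl//.
by rewrite mul1r lerDl.
Qed.

Lemma two_div_small (R : realType) (e : R) :
  0 < e -> exists n : nat, 2 / n.+2%:R < e.
Proof.
move=> e0; exists (Num.truncn (2 / e)).
rewrite ltr_pdivrMr// mulrC -ltr_pdivrMr//.
by apply: (lt_le_trans (truncnS_gt _)); rewrite ler_nat.
Qed.

Section SquareRoot.
Variables (R : realType) (A : cstarAlgType R).
Implicit Types (a b x y : A).

(* The fixed point z = (y + z^2) / 2 is 1 - sqrt (1 - y). The steps of the
   iteration are bounded by those of the scalar iteration with y = 1, which
   converges to 1 at an explicit rate. *)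
Fixpoint sqrt_iter y n : A :=
  if n is n'.+1 then 2^-1 *: (y + sqrt_iter y n' * sqrt_iter y n') else 0.

Fixpoint sqrt_bound n : R :=
  if n is n'.+1 then (1 + sqrt_bound n' ^+ 2) / 2 else 0.

Lemma sqrt_bound_itv n : 0 <= sqrt_bound n <= 1.
Proof.
elim: n => [|n /andP[n0 n1]] /=; first by rewrite lexx ler01.
have : sqrt_bound n ^+ 2 <= 1 by rewrite expr_le1.
have := sqr_ge0 (sqrt_bound n); lra.
Qed.

(** For [d = 1 - s] the recursion reads [d' = d - d^2 / 2], which decays like [2 / n]. *)
Lemma sqrt_bound_rate n : 1 - sqrt_bound n <= 2 / n.+2%:R.
Proof.
elim: n => [|n IH]; first by rewrite /= subr0 divff.
have /andP[n0 n1] := sqrt_bound_itv n.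
have n2 : (0 : R) < n.+2%:R by [].
rewrite ler_pdivlMr//= in IH *.
rewrite -(natr1 n.+2).
set m : R := n.+2%:R in n2 IH *; set s := sqrt_bound n in n0 n1 IH *.
rewrite ler_pdivlMr ?addr_gt0//.
have -> : 1 - (1 + s ^+ 2) / 2 = (1 - s) - (1 - s) ^+ 2 / 2 by field.
set d := 1 - s in IH *.
have d0 : 0 <= d by rewrite subr_ge0.
have d1 : d <= 1 by rewrite /d; lra.
(* If [d (m + 1) > 2], then [(d - d^2 / 2) (m + 1) <= d (m + 1) - d = d m <= 2] by induction;
   otherwise dropping the square suffices. *)
have [h|h] := leP (d * (m + 1)) 2.
  have : 0 <= d ^+ 2 * (m + 1) by rewrite mulr_ge0 ?sqr_ge0// addr_ge0// ltW.
  lra.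
have : 0 <= d * (d * (m + 1) - 2) by rewrite mulr_ge0// subr_ge0 ltW.
lra.
Qed.

Lemma norm_sqrt_iter y n : `|y| <= 1 -> `|sqrt_iter y n| <= (sqrt_bound n)%:C.
Proof.
move=> y1; elim: n => [|n IH] /=; first by rewrite normr0.
rewrite normrZ mulrC normfV normr_nat rmorphM/= fmorphV/= rmorph_nat.
rewrite ler_pM2r ?invr_gt0//.
apply: (le_trans (ler_normD _ _)); rewrite rmorphD rmorph1 lerD//.
apply: (le_trans (cstar_normMle _ _)); rewrite rmorphXn expr2.
exact: ler_pM.
Qed.

(** Both sides factor alike: [z^2 - w^2 = z (z - w) + (z - w) w], and each factor is bounded by its
    scalar counterpart. *)
Lemma sqrt_iter_step y n : `|y| <= 1 ->
  `|sqrt_iter y n.+1 - sqrt_iter y n| <= (sqrt_bound n.+1 - sqrt_bound n)%:C.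
Proof.
move=> y1; elim: n => [|n IH].
  rewrite /= mulr0 addr0 !subr0 expr0n/= addr0 normrZ normfV normr_nat.
  by rewrite mul1r fmorphV/= rmorph_nat -[leRHS]mulr1 ler_pM2l// invr_gt0.
set z := sqrt_iter y n.+1; set w := sqrt_iter y n.
set s := sqrt_bound n.+1; set t := sqrt_bound n.
have -> : sqrt_iter y n.+2 = 2^-1 *: (y + z * z) by [].
have -> : sqrt_bound n.+2 = (1 + s ^+ 2) / 2 by [].
rewrite [in X in `|_ - X|]/z [in X in (_ - X)%:C]/s /= -/w -/t.
have -> : 2^-1 *: (y + z * z) - 2^-1 *: (y + w * w)
        = 2^-1 *: (z * (z - w) + (z - w) * w).
  rewrite -scalerBr mulrBr mulrBl; congr (_ *: _).
  by rewrite opprD addrACA subrr add0r addrA subrK.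
have -> : (1 + s ^+ 2) / 2 - (1 + t ^+ 2) / 2
        = 2^-1 * (s * (s - t) + (s - t) * t) by field.
rewrite normrZ normfV normr_nat rmorphM/= fmorphV/= rmorph_nat.
rewrite ler_pM2l ?invr_gt0//.
apply: (le_trans (ler_normD _ _)); rewrite rmorphD lerD//.
  apply: (le_trans (cstar_normMle _ _)); rewrite rmorphM.
  by rewrite ler_pM// norm_sqrt_iter.
apply: (le_trans (cstar_normMle _ _)); rewrite rmorphM.
by rewrite ler_pM// norm_sqrt_iter.
Qed.

Lemma sqrt_iter_dist y n k : `|y| <= 1 ->
  `|sqrt_iter y (n + k) - sqrt_iter y n|
    <= (sqrt_bound (n + k) - sqrt_bound n)%:C.
Proof.
move=> y1; elim: k => [|k IH]; first by rewrite addn0 !subrr normr0.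
rewrite addnS -(subrKA (sqrt_iter y (n + k))) -(subrKA (sqrt_bound (n + k))).
rewrite rmorphD; apply: (le_trans (ler_normD _ _)).
by rewrite lerD// sqrt_iter_step.
Qed.

Lemma sqrt_iter_rate y n k : `|y| <= 1 ->
  `|sqrt_iter y (n + k) - sqrt_iter y n| <= (2 / n.+2%:R)%:C.
Proof.
move=> y1; apply: (le_trans (sqrt_iter_dist _ _ y1)).
rewrite lecR; apply: (le_trans _ (sqrt_bound_rate n)).
by rewrite lerD2r; case/andP: (sqrt_bound_itv (n + k)).
Qed.

Lemma sqrt_iter_cvg y : `|y| <= 1 ->
  exists z, forall e : R, 0 < e ->
    exists N, forall n, (N <= n)%N -> `|z - sqrt_iter y n| < e%:C.
Proof.
move=> y1.
have /cauchy_cvg cv : cauchy (sqrt_iter y @ \oo).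
  apply/cauchy_exP => e e0 /=.
  have /complex_realP[r er] := gtr0_real e0; rewrite er (ltcR 0) in e0 *.
  have [N hN] := two_div_small e0.
  exists (sqrt_iter y N); exists N => // n /= Nn.
  rewrite -ball_normE /= -(subnKC Nn) distrC.
  by apply: (le_lt_trans (sqrt_iter_rate _ _ y1)); rewrite ltcR.
exists (lim (sqrt_iter y @ \oo)) => e e0.
have /cvgrPdist_lt/(_ e%:C) := cv.
rewrite (ltcR 0) => /(_ e0)[N _ hN].
by exists N => n Nn; exact: hN.
Qed.

(** The last clause carries closed properties of the iterates over to the limit; it later yields
    self-adjointness, commutation and membership in subalgebras. *)
Lemma sqrt_1B y : `|y| <= 1 -> exists z : A,
  [/\ `|z| <= 1, (1 - z) * (1 - z) = 1 - y &
   forall U : set A, closed U -> U 0 ->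
     (forall w, U w -> U (2^-1 *: (y + w * w))) -> U z].
Proof.
move=> y1; have [z zP] := sqrt_iter_cvg y1.
have iter_le1 n : `|sqrt_iter y n| <= 1.
  apply: (le_trans (norm_sqrt_iter _ y1)).
  by rewrite (lecR _ 1); case/andP: (sqrt_bound_itv n).
have zU (U : set A) : closed U -> U 0 ->
     (forall w, U w -> U (2^-1 *: (y + w * w))) -> U z.
  move=> cU U0 Uw; apply: (closed_approx cU) => e /zP[N hN].
  by exists (sqrt_iter y N); [elim: N {hN} => //= n; exact: Uw | exact: hN].
have z1 : `|z| <= 1.
  have [r r0 zr] := norm_real_complex z.
  rewrite zr (lecR _ 1); apply/ler_addgt0Pr => e /zP[N /(_ N (leqnn _)) hN].
  rewrite -lecR -zr -(subrK (sqrt_iter y N) z) addrC rmorphD.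
  by apply: (le_trans (ler_normD _ _)); rewrite lerD// ltW.
exists z; split=> //.
(* The limit is a fixed point: two consecutive iterates lie within [e / 2] of [z], and the iteration
   map is a contraction in the weak sense on the unit ball. *)
have zE : z = 2^-1 *: (y + z * z).
  apply/eqP; rewrite -subr_eq0; apply/eqP/norm_approx_eq0 => e e0.
  have e2 : 0 < e / 2 by lra.
  have [N hN] := zP _ e2.
  have h0 := hN _ (leqnn N); have h1 := hN _ (leqnSn N).
  rewrite -(subrKA (sqrt_iter y N.+1)) (splitr e) rmorphD.
  apply: (le_trans (ler_normD _ _)); rewrite lerD//; first exact: ltW.
  set w := sqrt_iter y N in h0 *; rewrite /= -/w -scalerBr.
  have -> : y + w * w - (y + z * z) = - (z * (z - w) + (z - w) * w).
    rewrite mulrBr mulrBl addrA subrK opprB opprD.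
    by rewrite addrACA subrr add0r.
  rewrite normrZ normrN normfV normr_nat ler_pdivrMl// mulr_natl mulr2n.
  apply: (le_trans (ler_normD _ _)); rewrite lerD//.
    apply: (le_trans (cstar_normMle _ _)); rewrite -[leRHS]mul1r.
    by rewrite ler_pM// ltW.
  apply: (le_trans (cstar_normMle _ _)); rewrite -[leRHS]mulr1.
  by rewrite ler_pM//; [exact: ltW | exact: iter_le1].
have zz : z * z = z + z - y.
  have : 2 *: z = y + z * z by rewrite {1}zE scalerA divff// scale1r.
  by rewrite scaler_nat mulr2n => ->; rewrite addrC addKr.
by rewrite mulrBl mul1r mulrBr mulr1 zz opprB (addrAC _ (- y)) addrK subrKA.
Qed.

End SquareRoot.

(** * Positive elements *)

Section Nonneg.
Variables (R : realType) (A : cstarAlgType R).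
Implicit Types (a b c d x y z s r w : A) (t u : R[i]) (B : set A).

(* a is self-adjoint with spectrum in [0, +oo[, expressed through the norm:
   `|t - a| <= t confines the spectrum of a to [0, 2t]. *)
Definition cstar_nonneg a : Prop :=
  star a = a /\ exists t : R[i], `|t *: 1 - a| <= t.

(** Closedness and the unit keep the iteration for square roots, and its limit, inside [B]. *)
Record star_subalgebra B : Prop := StarSubalgebra {
  star_subalgebra_closed : closed B ;
  star_subalgebra1 : B 1 ;
  star_subalgebraD : forall a b, B a -> B b -> B (a + b) ;
  star_subalgebraZ : forall t a, B a -> B (t *: a) ;
  star_subalgebraM : forall a b, B a -> B b -> B (a * b) ;
  star_subalgebra_star : forall a, B a -> B (star a) }.

Lemma star_subalgebra0 B : star_subalgebra B -> B 0.
Proof.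
move=> sB; rewrite -(scale0r (1 : A)); apply: (star_subalgebraZ sB).
exact: star_subalgebra1.
Qed.

Lemma star_subalgebraN B a : star_subalgebra B -> B a -> B (- a).
Proof. by move=> sB Ba; rewrite -scaleN1r; exact: star_subalgebraZ. Qed.

Lemma star_subalgebraB B a b : star_subalgebra B -> B a -> B b -> B (a - b).
Proof.
by move=> sB Ba Bb; apply: star_subalgebraD => //; exact: star_subalgebraN.
Qed.

Lemma commutant_closed w : closed [set x | w * x - x * w = 0].
Proof.
have [k k0 wk] := norm_real_complex w.
apply: (@closed_kernel _ _ _ (fun x => w * x - x * w) (k + k)) => [x y|x].
  by rewrite mulrBr mulrBl !opprD addrACA.
rewrite rmorphD mulrDl /= -wk; apply: (le_trans (ler_normB _ _)).
apply: lerD; first exact: cstar_normMle.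
by rewrite mulrC; exact: cstar_normMle.
Qed.

Lemma selfadjoint_closed : closed [set x : A | star x - x = 0].
Proof.
apply: (@closed_kernel _ _ _ (fun x : A => star x - x) 2) => [x y|x].
  by rewrite cstarB !opprD addrACA.
rewrite rmorph_nat mulr_natl mulr2n -{1}(cstar_norm_star x).
exact: ler_normB.
Qed.

Lemma selfadjoint_scalar t : 0 <= t -> star (t *: 1 : A) = t *: 1.
Proof. by move=> t0; rewrite starZ cstar1 geC0_conj. Qed.

Lemma nonneg_sa a : cstar_nonneg a -> star a = a.
Proof. by case. Qed.

Lemma nonneg_bound a : cstar_nonneg a -> exists2 t, 0 <= t & `|t *: 1 - a| <= t.
Proof. by case=> _ [t ht]; exists t => //; apply: (le_trans _ ht). Qed.

Lemma nonneg0 : cstar_nonneg 0.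
Proof. by split; [exact: cstar0 | exists 0; rewrite scale0r subr0 normr0]. Qed.

Lemma nonnegD a b : cstar_nonneg a -> cstar_nonneg b -> cstar_nonneg (a + b).
Proof.
move=> [sa [t ta]] [sb [u bu]]; split; first by rewrite starD sa sb.
exists (t + u); rewrite scalerDl opprD addrACA.
by apply: (le_trans (ler_normD _ _)); exact: lerD.
Qed.

Lemma nonnegZ t a : 0 <= t -> cstar_nonneg a -> cstar_nonneg (t *: a).
Proof.
move=> t0 [sa [u au]]; split; first by rewrite starZ sa geC0_conj.
exists (t * u); rewrite -scalerA -scalerBr normrZ ger0_norm//.
exact: ler_wpM2l.
Qed.

Lemma nonnegZ_pos t a : 0 < t -> cstar_nonneg (t *: a) -> cstar_nonneg a.
Proof.
move=> t0 ha; rewrite -(scale1r a) -(mulVf (lt0r_neq0 t0)) -scalerA.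
by apply: nonnegZ => //; rewrite invr_ge0 ltW.
Qed.

Lemma norm_nonnegB c t : star c = c -> `|c| <= t -> cstar_nonneg (t *: 1 - c).
Proof.
move=> sc ct; split; last by exists t; rewrite subKr.
by rewrite cstarB sc selfadjoint_scalar// (le_trans _ ct).
Qed.

Lemma nonneg_scalar t : 0 <= t -> cstar_nonneg (t *: 1).
Proof.
by move=> t0; rewrite -[_ *: _]subr0; apply: norm_nonnegB;
  rewrite ?cstar0 ?normr0.
Qed.

(** If [|t - a| <= t] with [t > 0], then [y = 1 - a / t] lies in the unit ball, and [sqrt t (1 - z)]
    is the root, where [(1 - z)^2 = 1 - y]. It is nonnegative because [|z| <= 1]. *)
Lemma nonneg_sqrt a : cstar_nonneg a -> exists r,
  [/\ cstar_nonneg r, r * r = a, forall w, w * a = a * w -> w * r = r * w &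
      forall B, star_subalgebra B -> B a -> B r].
Proof.
move=> pa; have [t t0 ta] := nonneg_bound pa; have sa := nonneg_sa pa.
(* The bound with [t = 0] forces [a = 0], which must be set apart before dividing by [t]. *)
have [tz|tn0] := eqVneq t 0.
  exists 0; suff -> : a = 0.
    by split; rewrite ?mulr0//; exact: nonneg0.
  apply/eqP; rewrite -normr_eq0 -normrN; apply/eqP/le_anti;
    rewrite normr_ge0 andbT.
  by rewrite -[- a]add0r -(scale0r 1) -tz.
have t_gt0 : 0 < t by rewrite lt_def tn0.
pose y := 1 - t^-1 *: a.
have sy : star y = y.
  by rewrite cstarB cstar1 starZ sa geC0_conj// invr_ge0.
have y1 : `|y| <= 1.
  have -> : y = t^-1 *: (t *: 1 - a) by rewrite scalerBr scalerA mulVf//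
    scale1r.
  by rewrite normrZ ger0_norm ?invr_ge0// ler_pdivrMl// mulr1.
have [z [z1 zz zU]] := sqrt_1B y1.
have sz : star z = z.
  apply/eqP; rewrite -subr_eq0; apply/eqP.
  apply: (zU _ selfadjoint_closed) => [|w /= /eqP];
    first by rewrite /= cstar0 subrr.
  rewrite subr_eq0 => /eqP sw; apply/eqP; rewrite subr_eq0.
  by rewrite starZ starD cstarM sw sy geC0_conj// invr_ge0.
have st0 : 0 <= sqrtC t by rewrite sqrtC_ge0.
exists (sqrtC t *: (1 - z)); split.
- rewrite scalerBr; apply: norm_nonnegB; first by rewrite starZ sz geC0_conj.
  by rewrite normrZ ger0_norm// ler_piMr.
- rewrite -scalerAl -scalerAr scalerA -expr2 sqrtCK zz.
  by rewrite subKr scalerA divff// scale1r.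
- move=> w wa; rewrite -scalerAr -scalerAl mulrBr mulrBl mulr1 mul1r.
  congr (_ *: (_ - _)); apply/eqP; rewrite -subr_eq0; apply/eqP.
  apply: (zU _ (@commutant_closed w)) => [|x /= /eqP];
    first by rewrite /= mulr0 mul0r subrr.
  rewrite subr_eq0 => /eqP wx; apply/eqP; rewrite subr_eq0 -scalerAr -scalerAl.
  rewrite mulrDr mulrDl mulrA wx -mulrA wx mulrA /y mulrBr mulrBl mulr1 mul1r.
  by rewrite -scalerAr -scalerAl wa.
- move=> B sB Ba; apply: (star_subalgebraZ sB).
  apply: star_subalgebraB => //; first exact: star_subalgebra1.
  apply: zU; [exact: star_subalgebra_closed|exact: star_subalgebra0|move=> w
    Bw].
  apply: (star_subalgebraZ sB); apply: (star_subalgebraD sB);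
    last exact: star_subalgebraM.
  apply: star_subalgebraB => //; first exact: star_subalgebra1.
  exact: star_subalgebraZ.
Qed.

(* x + i s is t times a unitary whose real part is x. *)
Lemma unitary_norm_le x s t : star x = x -> star s = s -> x * s = s * x ->
  0 <= t -> x * x + s * s = t ^+ 2 *: 1 -> `|x| <= t.
Proof.
move=> sx ss xs t0 xxss.
pose v := x + 'i *: s.
have sv : star v = x - 'i *: s.
  by rewrite starD starZ sx ss conjCi scaleNr.
have vv : star v * v = t ^+ 2 *: 1.
  rewrite sv mulrDr !mulrBl -!scalerAr -!scalerAl scalerA -(expr2 ('i : R[i]))
    sqrCi xs.
  by rewrite scaleN1r opprK addrA subrK.
have nv : `|v| = t.
  apply/eqP; rewrite -(eqrXn2 (n := 2))// -cstar_normC vv normrZ cstar_norm1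
    mulr1.
  by rewrite ger0_norm// exprn_ge0.
have : `|v + star v| <= t + t.
  by apply: (le_trans (ler_normD _ _)); rewrite cstar_norm_star nv.
rewrite sv /v addrACA subrr addr0 -!mulr2n -scaler_nat normrZ normr_nat.
by rewrite -[t *+ 2]mulr_natl ler_pM2l.
Qed.

(** After scaling to [|y| <= 1], let [s] be the root of [1 - y^2]. Then [s + i y] is unitary, so
    [|s| <= 1] and [|1 - y^2| = |s^2| <= 1]. *)
Lemma nonneg_sq x : star x = x -> cstar_nonneg (x * x).
Proof.
move=> sx; have [->|x0] := eqVneq x 0; first by rewrite mul0r; exact: nonneg0.
have nx0 : 0 < `|x| by rewrite normr_gt0.
suff h y : star y = y -> `|y| <= 1 -> cstar_nonneg (y * y).
  rewrite -[x]scale1r -(divff (lt0r_neq0 nx0)) -scalerA -scalerAl -scalerAr.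
  do 2 (apply: nonnegZ => //); apply: h; last first.
    by rewrite normrZ ger0_norm ?invr_ge0// mulVf// lt0r_neq0.
  by rewrite starZ sx geC0_conj// invr_ge0.
move=> sy y1; split; first by rewrite cstarM sy.
have yy1 : `|y * y| <= 1.
  by apply: (le_trans (cstar_normMle _ _)); rewrite mulr_ile1.
have pyy : cstar_nonneg (1 - y * y).
  by rewrite -(scale1r 1); apply: norm_nonnegB => //; rewrite cstarM sy.
have [s [ps ss sw _]] := nonneg_sqrt pyy.
have s1 : `|s| <= 1.
  apply: (@unitary_norm_le _ y) => //; first exact: nonneg_sa.
    by apply/esym/sw; rewrite mulrBr mulrBl mulr1 mul1r mulrA.
  by rewrite ss subrK expr1n scale1r.
exists 1; rewrite scale1r -ss.
by apply: (le_trans (cstar_normMle _ _)); rewrite mulr_ile1.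
Qed.

(** The roots [r] and [s] commute, so [a b] is the square of the self-adjoint element [r s]. *)
Lemma nonneg_mul_comm a b : cstar_nonneg a -> cstar_nonneg b -> a * b = b * a ->
  cstar_nonneg (a * b).
Proof.
move=> /nonneg_sqrt[r [pr rr rc _]] /nonneg_sqrt[s [ps ss sc _]] ab.
have rs : r * s = s * r by apply: sc; apply/esym/rc.
have -> : a * b = (r * s) * (r * s).
  by rewrite -rr -ss [RHS]mulrA -(mulrA r s r) -rs !mulrA.
by apply: nonneg_sq; rewrite cstarM (nonneg_sa pr) (nonneg_sa ps).
Qed.

(** The product [(t - c) (t + c) = t^2 - c^2] has a root [s] commuting with [c], and [c + i s] is
    [t] times a unitary. *)
Lemma norm_le_nonneg c t : star c = c -> 0 <= t ->
  cstar_nonneg (t *: 1 - c) -> cstar_nonneg (t *: 1 + c) -> `|c| <= t.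
Proof.
move=> sc t0 pm pp.
have e : (t *: 1 - c) * (t *: 1 + c) = t ^+ 2 *: 1 - c * c.
  rewrite mulrDr !mulrBl -!scalerAl -!scalerAr !mul1r mulr1 scalerA -(expr2 t).
  by rewrite addrA subrK.
have e' : (t *: 1 + c) * (t *: 1 - c) = t ^+ 2 *: 1 - c * c.
  rewrite mulrBr !mulrDl -!scalerAl -!scalerAr !mul1r mulr1 scalerA -(expr2 t).
  by rewrite opprD addrA addrK.
have := nonneg_mul_comm pm pp; rewrite e e' => /(_ erefl).
move=> /nonneg_sqrt[s [ps ss sw _]].
apply: (@unitary_norm_le _ s) => //; first exact: nonneg_sa.
  by apply: sw; rewrite mulrBr mulrBl -scalerAl -scalerAr mulr1 mul1r mulrA.
by rewrite ss addrC subrK.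
Qed.

Lemma nonneg_anti a : cstar_nonneg a -> cstar_nonneg (- a) -> a = 0.
Proof.
move=> pa pNa; apply/eqP; rewrite -normr_eq0; apply/eqP/le_anti.
rewrite normr_ge0 andbT; apply: norm_le_nonneg => //.
- exact: nonneg_sa.
- by rewrite scale0r add0r.
- by rewrite scale0r add0r.
Qed.

Lemma nonneg_norm_le a t : cstar_nonneg a -> 0 <= t ->
  cstar_nonneg (t *: 1 - a) -> `|a| <= t.
Proof.
move=> pa t0 pta; apply: norm_le_nonneg => //; first exact: nonneg_sa.
by apply: nonnegD => //; exact: nonneg_scalar.
Qed.

(** Twice the sum equals [h^2 + k^2] for the self-adjoint [h = d + star d] and
    [k = i (d - star d)]. *)
Lemma nonneg_starD_star d : cstar_nonneg (d * star d + star d * d).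
Proof.
apply: (@nonnegZ_pos 2) => //.
have -> : 2 *: (d * star d + star d * d) =
    (d + star d) * (d + star d)
    + ('i *: (d - star d)) * ('i *: (d - star d)).
  rewrite -scalerAl -scalerAr scalerA -(expr2 ('i : R[i])) sqrCi scaleN1r
    scaler_nat mulr2n.
  rewrite mulrBl !mulrBr mulrDl !mulrDr.
  set p := d * d; set w := star d * star d.
  set q := d * star d; set v := star d * d.
  have -> : p + q + (v + w) = (p + w) + (q + v) by rewrite (addrC v) addrACA.
  have -> : p - q - (v - w) = (p + w) - (q + v) by rewrite opprB addrACA -opprD.
  by rewrite opprB [RHS]addrC subrKA.
apply: nonnegD; apply: nonneg_sq; first by rewrite starD starK addrC.
by rewrite starZ cstarB starK conjCi scaleNr -scalerN opprB.
Qed.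

(* With e = - d^* d = g^2 and D = d g, both D^* D = - e^2 and
   D D^* = - f^2, where f = d d^*, are nonpositive, while D D^* + D^* D is
     nonnegative. *)
Lemma star_mul_nonpos_eq0 d : cstar_nonneg (- (star d * d)) -> d = 0.
Proof.
move=> pe.
have pf : cstar_nonneg (d * star d).
  by rewrite -(addrK (star d * d) (d * star d)); apply: nonnegD => //;
    exact: nonneg_starD_star.
have [g [pg gg _ _]] := nonneg_sqrt pe.
have sg := nonneg_sa pg.
set e := - (star d * d) in pe gg.
set f := d * star d in pf.
have := nonneg_starD_star (d * g).
have -> : d * g * star (d * g) = - (f * f).
  rewrite cstarM sg -!mulrA (mulrA g) gg /e /f !mulrA.
  by rewrite mulrN mulNr !mulrA.
have -> : star (d * g) * (d * g) = - (e * e).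
  rewrite cstarM sg -!mulrA (mulrA (star d)) -[star d * d]opprK -/e.
  by rewrite mulNr mulrN -{1}gg -gg !mulrA.
(* Adding [f^2] to [- f^2 - e^2] shows that [- e^2] is nonnegative, whence [e^2 = 0]. *)
move=> h; have pee : cstar_nonneg (- (e * e)).
  rewrite -(addKr (- (f * f)) (- (e * e))) opprK addrC; apply: nonnegD => //.
  exact/nonneg_sq/nonneg_sa.
have e0 : e * e = 0 by apply: nonneg_anti => //; exact/nonneg_sq/nonneg_sa.
have /eqP : e = 0 by apply: cstar_sq_eq0 => //; exact: nonneg_sa.
rewrite oppr_eq0 -normr_eq0 cstar_normC sqrf_eq0 normr_eq0; exact/eqP.
Qed.

(* For a = x^* x, b = |a| and q = b - a one has a q = - b q, so
   (x q)^* (x q) = - b q^2 is nonpositive; hence x q = 0, and then q = 0. *)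
Lemma star_mul_nonneg x : cstar_nonneg (star x * x).
Proof.
set a := star x * x.
have sa : star a = a by rewrite cstarM starK.
have [b [pb bb bc _]] := nonneg_sqrt (nonneg_sq sa).
have ab : a * b = b * a by apply: bc; rewrite mulrA.
have sb := nonneg_sa pb.
pose q := b - a.
have sq : star q = q by rewrite cstarB sa sb.
have aq : a * q = - (b * q).
  by rewrite !mulrBr bb ab opprB.
have bq : b * q = q * b by rewrite mulrBr mulrBl ab.
have bqq0 : b * (q * q) = 0.
  have dd : star (x * q) * (x * q) = - (b * (q * q)).
    by rewrite cstarM sq -mulrA (mulrA (star x)) -/a aq mulrN !mulrA -bq.
  have : x * q = 0.
    apply: star_mul_nonpos_eq0; rewrite dd opprK.
    apply: nonneg_mul_comm => //; first exact: nonneg_sq.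
    by rewrite mulrA bq -mulrA bq mulrA.
  by move=> xq0; move: dd; rewrite xq0 mulr0 => /eqP;
    rewrite eq_sym oppr_eq0 => /eqP.
(* Here [q^3 = b q^2 - a q^2] and [a q^2 = - b q^2 = 0]; two uses of the C*-identity then descend
   from [q^4 = 0] to [q = 0]. *)
have q3 : q * (q * q) = 0.
  by rewrite {1}/q mulrBl bqq0 mulrA aq mulNr -mulrA bqq0 oppr0 subr0.
have qq0 : q * q = 0.
  by apply: cstar_sq_eq0; rewrite ?cstarM ?sq// -mulrA q3 mulr0.
have /eqP : q = 0 by exact: cstar_sq_eq0.
by rewrite subr_eq0 => /eqP <-.
Qed.

(** Bridge between the form [star b * b] and the norm criterion, from which roots are built. *)
Lemma positive_nonneg a : cstar_positive a <-> cstar_nonneg a.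
Proof.
split=> [[b ->]|/nonneg_sqrt[r [pr rr _ _]]]; first exact: star_mul_nonneg.
by exists r; rewrite (nonneg_sa pr).
Qed.

(* For d = x - y, the nonnegative elements d^2 x and d^2 y have sum
   d (x^2 - y^2) = 0, so both vanish and d^3 = 0. *)
Lemma nonneg_sqrt_unique b r : cstar_nonneg b -> cstar_nonneg r ->
  b * b = r * r -> b = r.
Proof.
(* The constructed root of [b^2] commutes with everything commuting with [b^2], hence with both [b]
   and [r]; so the commuting case suffices. *)
suff h x y : cstar_nonneg x -> cstar_nonneg y -> x * y = y * x -> x * x = y * y
  ->
    x = y.
  move=> pb pr br.
  have [s [ps ss sc _]] := nonneg_sqrt (nonneg_sq (nonneg_sa pb)).
  have -> : b = s by apply: h; rewrite // sc// mulrA.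
  by apply/esym/h; rewrite // ?ss// sc// br mulrA.
move=> px py xy xxyy; pose d := x - y.
have sd : star d = d by rewrite cstarB !nonneg_sa.
have pdd := nonneg_sq sd.
have dx : d * x = x * d by rewrite mulrBr mulrBl xy.
have dy : d * y = y * d by rewrite mulrBr mulrBl xy.
have pdx : cstar_nonneg (d * d * x).
  by apply: nonneg_mul_comm => //; rewrite -mulrA dx mulrA dx mulrA.
have pdy : cstar_nonneg (d * d * y).
  by apply: nonneg_mul_comm => //; rewrite -mulrA dy mulrA dy mulrA.
have s0 : d * d * x + d * d * y = 0.
  have dxy : d * (x + y) = 0.
    by rewrite mulrBl !mulrDr xxyy xy (addrC (y * y)) subrr.
  by rewrite -mulrDr -mulrA dxy mulr0.
have dx0 : d * d * x = 0.
  apply: nonneg_anti => //; have /eqP := s0.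
  by rewrite addrC addr_eq0 => /eqP <-.
have dy0 : d * d * y = 0 by rewrite dx0 add0r in s0.
have d3 : d * d * d = 0 by rewrite {3}/d mulrBr dx0 dy0 subrr.
have dd0 : d * d = 0.
  by apply: cstar_sq_eq0; rewrite ?cstarM ?sd// mulrA d3 mul0r.
by apply/eqP; rewrite -subr_eq0; apply/eqP; exact: cstar_sq_eq0.
Qed.

End Nonneg.

(** * The Hahn-Banach theorem *)

(* The majorant of a sublinear functional is replaced by its epigraph D, and a
   linear functional on a subspace by its graph G. *)
Lemma hahn_banach_epigraph (R : realType) (V : lmodType R)
    (D : V -> R -> Prop) (G : set (V * R)) :
  D 0 0 ->
  (forall x y s t, D x s -> D y t -> D (x + y) (s + t)) ->
  (forall c x s, 0 < c -> D x s -> D (c *: x) (c * s)) ->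
  (forall x, exists s, D x s) ->
  G (0, 0) ->
  (forall c x r y s, G (x, r) -> G (y, s) -> G (c *: x + y, c * r + s)) ->
  (forall x r s, G (x, r) -> D x s -> r <= s) ->
  exists g : V -> R,
    [/\ forall c x y, g (c *: x + y) = c * g x + g y,
        forall x s, D x s -> g x <= s & forall x r, G (x, r) -> g x = r].
Proof.
move=> D0 DD DZ Dex G0 Glin Gdom.
pose adm (H : set (V * R)) :=
  (forall c x r y s, H (x, r) -> H (y, s) -> H (c *: x + y, c * r + s)) /\
  (forall x r s, H (x, r) -> D x s -> r <= s).
(* Admissibility is asked of the union with [G], so that the empty chain is harmless and the maximal
   graph [H] contains [G]. *)
have [A [[Hlin Hdom] maxA]] : exists A, adm (A `|` G) /\
    forall B, A `<` B -> ~ adm (B `|` G).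
  apply: (@Zorn_bigcup _ [set A | adm (A `|` G)]) => F FP Ftot.
  split=> [c x r y s|x r s [[X FX Xxr]|Gxr]]; last first.
  - exact: Gdom.
  - by have [_] := FP _ FX; apply; left.
  move=> [[X FX Xxr]|Gxr] [[Y FY Yys]|Gys].
  - suff [Z [FZ Zxr Zys]] : exists Z, [/\ F Z, Z (x, r) & Z (y, s)].
      have [Zlin _] := FP _ FZ.
      by have [h|h] := Zlin c _ _ _ _ (or_introl Zxr) (or_introl Zys);
        [left; exists Z | right].
    have [XY|YX] := Ftot _ _ FX FY; first by exists Y; split=> //; exact: XY.
    by exists X; split=> //; exact: YX.
  - have [Xlin _] := FP _ FX.
    by have [h|h] := Xlin c _ _ _ _ (or_introl Xxr) (or_intror Gys);
      [left; exists X | right].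
  - have [Ylin _] := FP _ FY.
    by have [h|h] := Ylin c _ _ _ _ (or_intror Gxr) (or_introl Yys);
      [left; exists Y | right].
  - by right; exact: Glin.
set H := A `|` G in Hlin Hdom.
have H0 : H (0, 0) by right.
have HZ c x r : H (x, r) -> H (c *: x, c * r).
  by move=> Hx; have := Hlin c _ _ _ _ Hx H0; rewrite !addr0.
have Htot v : exists r, H (v, r).
  apply: contrapT => /forallNP Nv.
  (* A value at [v] must be at least every element [r - s] of [S] and, as [Sle] records, at most
     every [s' - t]. The supremum of [S] meets both demands. *)
  pose S := [set z : R | exists x r s, [/\ H (x, r), D (x - v) s & z = r - s]].
  have Sle y t s' : H (y, t) -> D (y + v) s' -> ubound S (s' - t).
    move=> Hy Dy _ [x [r [s [Hx Dx ->]]]].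
    have Hxy : H (x + y, r + t).
      by have := Hlin 1 _ _ _ _ Hx Hy; rewrite scale1r mul1r.
    have Dxy : D (x + y) (s + s').
      by have := DD _ _ _ _ Dx Dy; rewrite (addrC y) subrKA.
    have := Hdom _ _ _ Hxy Dxy; lra.
  have Sub : has_ubound S.
    by have [s' Ds'] := Dex (0 + v); exists (s' - 0); apply: Sle Ds'.
  have S0 : S !=set0.
    by have [s Ds] := Dex (0 - v); exists (0 - s); exists 0, 0, s.
  pose c := sup S.
  pose H' : set (V * R) := [set z | exists x r l,
    H (x, r) /\ z = (x + l *: v, r + l * c)].
  have HH' z : H z -> H' z.
    by case: z => x r Hx; exists x, r, 0; rewrite scale0r mul0r !addr0.
  apply: (maxA H').
    split; first by move=> z Az; apply: HH'; left.
    move=> H'A; apply: (Nv c); left; apply: H'A.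
    by exists 0, 0, 1; rewrite scale1r mul1r !add0r.
  have -> : H' `|` G = H'.
    by apply/setUidPl => z Gz; apply: HH'; right.
  split=> [b x r y s|x r s].
    move=> [x1 [r1 [l1 [H1 [-> ->]]]]] [x2 [r2 [l2 [H2 [-> ->]]]]].
    exists (b *: x1 + x2), (b * r1 + r2), (b * l1 + l2).
    split; first exact: Hlin.
    congr (_, _); last by ring.
    by rewrite scalerDr scalerA scalerDl addrACA.
  move=> [x1 [r1 [l [H1 [-> ->]]]]] Dxs.
  (* Division by [|l|] reduces domination at [x1 + l v] to [c] bounding [S] above if [l < 0], and to
     [c] being its least upper bound if [l > 0]. *)
  have [l0|l0|l0] := ltgtP l 0.
  - have m0 : 0 < (- l)^-1 by rewrite invr_gt0 oppr_gt0.
    have ln0 : l != 0 by rewrite lt_eqF.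
    have Dm := DZ _ _ _ m0 Dxs.
    rewrite scalerDr scalerA invrN mulNr mulVf// scaleN1r in Dm.
    have Hm := HZ (- l^-1) _ _ H1.
    have /(ub_le_sup Sub) : S (- l^-1 * r1 - - l^-1 * s).
      by exists (- l^-1 *: x1), (- l^-1 * r1), (- l^-1 * s).
    rewrite -/c -mulrBr -invrN ler_pdivrMl ?oppr_gt0//; lra.
  - have m0 : 0 < l^-1 by rewrite invr_gt0.
    have ln0 : l != 0 by rewrite gt_eqF.
    have Dm := DZ _ _ _ m0 Dxs.
    rewrite scalerDr scalerA mulVf// scale1r in Dm.
    have Hm := HZ l^-1 _ _ H1.
    have := ge_sup S0 (Sle _ _ _ Hm Dm).
    rewrite -/c -mulrBr ler_pdivlMl//; lra.
  - rewrite l0 mul0r addr0; apply: (Hdom _ _ _ H1).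
    by move: Dxs; rewrite l0 scale0r addr0.
(* Two values [a], [b] at one point put [(0, a - b)] in [H], and [D 0 0] gives [a <= b]. *)
have Hfun x r s : H (x, r) -> H (x, s) -> r = s.
  suff h a b : H (x, a) -> H (x, b) -> a <= b.
    by move=> Hr Hs; apply/le_anti; rewrite !h.
  move=> Ha Hb; have := Hlin (-1) _ _ _ _ Hb Ha.
  rewrite scaleN1r addNr => /Hdom/(_ D0); lra.
have [g gP] := choice Htot; exists g; split=> [c x y|x s|x r Gxr].
- exact: Hfun (gP _) (Hlin _ _ _ _ _ (gP x) (gP y)).
- exact: Hdom.
- by apply: Hfun (gP x) _; right.
Qed.

(** An alias carrying the real scalar action, so that it does not clash with the complex one on
    [V]. *)
Definition realification (R : realType) (V : lmodType R[i]) : Type := V.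

HB.instance Definition _ (R : realType) (V : lmodType R[i]) :=
  GRing.Zmodule.on (realification V).

Section Realification.
Variables (R : realType) (V : lmodType R[i]).

Let rscale (c : R) (x : realification V) : realification V := c%:C *: (x : V).

Fact rscaleA a b (v : realification V) : rscale a (rscale b v) = rscale (a * b)
  v.
Proof. by rewrite /rscale scalerA rmorphM. Qed.

Fact rscale1 : left_id 1 rscale.
Proof. by move=> v; rewrite /rscale rmorph1 scale1r. Qed.

Fact rscaleDr : right_distributive rscale +%R.
Proof. by move=> c x y; exact: scalerDr. Qed.

Fact rscaleDl (v : realification V) : {morph rscale^~ v: a b / a + b}.
Proof. by move=> a b; rewrite /rscale rmorphD; exact: scalerDl. Qed.

HB.instance Definition _ := GRing.Zmodule_isLmodule.Build R (realification V)
  rscaleA rscale1 rscaleDr rscaleDl.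

Lemma realification_scaleE (c : R) (x : realification V) :
  c *: x = c%:C *: (x : V).
Proof. by []. Qed.

End Realification.

(** * Positive functionals and states *)

Section PositiveFunctionals.
Variables (R : realType) (A : cstarAlgType R).
Implicit Types (a b n x y : A) (c : R[i]).

Definition positive_functional (B : set A) (f : A -> R[i]) : Prop :=
  (forall c a b, B a -> B b -> f (c *: a + b) = c * f a + f b) /\
  (forall a, B a -> 0 <= f (star a * a)).

Section OnSubalgebra.
Variables (B : set A) (f : A -> R[i]).
Hypotheses (sB : star_subalgebra B) (pf : positive_functional B f).

Let B0 : B 0 := star_subalgebra0 sB.
Let B1 : B 1 := star_subalgebra1 sB.

Lemma functional0 : f 0 = 0.
Proof.
have := pf.1 1 0 0 B0 B0; rewrite scale1r addr0 mul1r => /eqP.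
by rewrite -subr_eq0 opprD addNKr oppr_eq0 => /eqP.
Qed.

Lemma functionalD a b : B a -> B b -> f (a + b) = f a + f b.
Proof. by move=> Ba Bb; rewrite -{1}(scale1r a) pf.1// mul1r. Qed.

Lemma functionalZ c a : B a -> f (c *: a) = c * f a.
Proof. by move=> Ba; rewrite -[c *: a]addr0 pf.1// functional0 addr0. Qed.

Lemma functionalN a : B a -> f (- a) = - f a.
Proof. by move=> Ba; rewrite -scaleN1r functionalZ// mulN1r. Qed.

Lemma functionalB a b : B a -> B b -> f (a - b) = f a - f b.
Proof.
move=> Ba Bb; rewrite functionalD ?functionalN//; exact: star_subalgebraN.
Qed.

(** Positivity of [f] is known only on elements of [B], so it matters that the root of [a] stays in
    [B]. *)
Lemma functional_ge0 a : B a -> cstar_nonneg a -> 0 <= f a.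
Proof.
move=> Ba /nonneg_sqrt[r [pr rr _ rB]]; rewrite -rr -{1}(nonneg_sa pr).
by apply: pf.2; exact: rB.
Qed.

Lemma functional1_ge0 : 0 <= f 1.
Proof. by have := pf.2 _ B1; rewrite cstar1 mulr1. Qed.

Lemma functional_le_norm_sa a : B a -> star a = a -> f a <= `|a| * f 1.
Proof.
move=> Ba sa.
have : 0 <= f (`|a| *: 1 - a).
  apply: functional_ge0; last exact: norm_nonnegB.
  by apply: (star_subalgebraB sB) => //; exact: star_subalgebraZ.
rewrite functionalB//; last exact: star_subalgebraZ.
by rewrite functionalZ// subr_ge0.
Qed.

(** In [R[i]] an inequality forces a real difference, so comparison with the real number [|a| f 1]
    makes [f a] real. *)
Lemma functional_real a : B a -> star a = a -> f a \is Num.real.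
Proof.
move=> Ba sa; rewrite (ler_real (functional_le_norm_sa Ba sa)).
by rewrite rpredM ?ger0_real ?functional1_ge0.
Qed.

(** [f] is real on [a + star a] and on [i (a - star a)]; the two resulting equations determine
    [f (star a)]. *)
Lemma functional_star a : B a -> f (star a) = (f a)^*%R.
Proof.
move=> Ba; have Bs := star_subalgebra_star sB Ba.
have h1 : f (a + star a) \is Num.real.
  by apply: functional_real; [exact: star_subalgebraD | rewrite starD starK
    addrC].
have h2 : f ('i *: (a - star a)) \is Num.real.
  apply: functional_real; last by rewrite starZ cstarB starK conjCi scaleNr
    -scalerN opprB.
  by apply: (star_subalgebraZ sB); exact: star_subalgebraB.
rewrite functionalD// in h1.
rewrite functionalZ ?functionalB// in h2; last exact: star_subalgebraB.
move/CrealP: h1; move/CrealP: h2.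
rewrite !rmorphM !rmorphB !rmorphD /= conjCi mulNr -mulrN => /(mulfI (neq0Ci
  _)).
rewrite opprB => h2 h1.
have n2 : (2 : R[i]) != 0 by rewrite pnatr_eq0.
apply: (mulfI n2); apply/esym.
have -> : 2 * (f a)^*%R =
    ((f a)^*%R + (f (star a))^*%R) - ((f (star a))^*%R - (f a)^*%R) by ring.
by rewrite h1 h2; ring.
Qed.

(** Multiplying [a] by a phase [l] makes the value [|f a|]; the self-adjoint bound then applies to
    [x + star x]. *)
Lemma functional_norm_le a : B a -> `|f a| <= `|a| * f 1.
Proof.
move=> Ba; have [->|fa0] := eqVneq (f a) 0.
  by rewrite normr0 mulr_ge0 ?functional1_ge0.
have nf0 : `|f a| != 0 by rewrite normr_eq0.
pose l := (f a)^*%R / `|f a|.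
have nl : `|l| = 1 by rewrite normrM normfV norm_conjC normr_id divff.
pose x := l *: a.
have Bx : B x by exact: star_subalgebraZ.
have Bsx : B (star x) by exact: star_subalgebra_star.
have nx : `|x| = `|a| by rewrite normrZ nl mul1r.
have fx : f x = `|f a|.
  by rewrite functionalZ// /l mulrAC -(mulrC (f a)) -normCK expr2 mulfK.
have := functional_le_norm_sa (star_subalgebraD sB Bx Bsx).
rewrite starD starK addrC => /(_ erefl).
rewrite functionalD// functional_star// fx conj_normC => h.
have : `|f a| + `|f a| <= (`|a| + `|a|) * f 1.
  apply: (le_trans h); rewrite ler_wpM2r ?functional1_ge0//.
  by apply: (le_trans (ler_normD _ _)); rewrite cstar_norm_star nx.
have n2 : (0 : R[i]) < 2 by rewrite ltr0n.
by move=> h2; rewrite -(ler_pM2l n2) !mulr_natl !mulr2n -mulrDl.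
Qed.

Lemma functional_cauchy_schwarz0 n x : B n -> B x -> star n = n -> f (n * n) =
  0 ->
  f (n * x) = 0.
Proof.
move=> Bn Bx sn fnn.
have Bsx := star_subalgebra_star sB Bx.
have BM a b : B a -> B b -> B (a * b) by exact: star_subalgebraM.
have BZ c a : B a -> B (c *: a) by exact: star_subalgebraZ.
have BD a b : B a -> B b -> B (a + b) by exact: star_subalgebraD.
set b := f (n * x).
have fxn : f (star x * n) = b^*%R.
  by rewrite -functional_star ?cstarM ?sn//; exact: BM.
pose g := f (star x * x).
have g0 : 0 <= g by exact: pf.2.
have g1 : 0 < g + 1 by rewrite ltr_wpDl.
have sqE (k : R[i]) : star (n + k *: x) * (n + k *: x) =
    n * n + (k *: (n * x) + (k^*%R *: (star x * n) + (k^*%R * k) *: (star x *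
      x))).
  rewrite starD sn starZ mulrDr !mulrDl -!scalerAl -!scalerAr scalerA -!addrA.
  by congr (_ + _); exact: addrCA.
(* With this [c] the value at [n + c x] is [- |b|^2 (g + 2) / (g + 1)^2], which can be nonnegative
   only for [b = 0]; [g + 1] avoids division by zero. *)
pose c := - (g + 1)^-1 * b^*%R.
have cc : c^*%R = - (g + 1)^-1 * b.
  by rewrite rmorphM rmorphN /= conjCK geC0_conj// invr_ge0 ltW.
have : 0 <= f (star (n + c *: x) * (n + c *: x)) by apply: pf.2; auto.
rewrite sqE.
rewrite functionalD; [|auto 10..]; rewrite functionalD; [|auto 10..].
rewrite functionalD; [|auto 10..]; rewrite !functionalZ; [|auto 10..].
rewrite fnn fxn -/b -/g add0r cc /c.
have -> : - (g + 1)^-1 * b^*%R * b +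
   (- (g + 1)^-1 * b * b^*%R + - (g + 1)^-1 * b * (- (g + 1)^-1 * b^*%R) * g)
   = - ((b * b^*%R) * ((g + 1)^-1 ^+ 2 * (g + 2))).
  by field; rewrite gt_eqF.
rewrite oppr_ge0 pmulr_lle0; last first.
  by rewrite mulr_gt0 ?exprn_gt0 ?invr_gt0// ltr_wpDl.
rewrite -normCK => h; apply/eqP; rewrite -normr_eq0 -sqrf_eq0 eq_le h.
by rewrite exprn_ge0.
Qed.

(** The supremum is attained at the unit, so the norm condition on a state becomes [f 1 = 1]. *)
Lemma functional_normE : functional_norm B f = (complex.Re (f 1))%:E.
Proof.
have f1 : f 1 = (complex.Re (f 1))%:C by rewrite RRe_real// ger0_real//
  functional1_ge0.
apply/eqP; rewrite eq_le; apply/andP; split.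
  apply: ge_ereal_sup => _ [a [Ba a1] <-]; rewrite lee_fin -lecR RRe_real// -f1.
  apply: (le_trans (functional_norm_le Ba)).
  by rewrite ler_piMl ?functional1_ge0.
apply: ereal_sup_ubound; exists (1 : A); first by split=> //;
  rewrite cstar_norm1.
by rewrite ger0_norm// functional1_ge0.
Qed.

End OnSubalgebra.

Lemma state_onE (B : set A) (f : A -> R[i]) : star_subalgebra B ->
  state_on B f <-> positive_functional B f /\ f 1 = 1.
Proof.
move=> sB; split=> [[fl fp]|[pf f1]].
  have pf : positive_functional B f by [].
  rewrite (functional_normE sB pf) => -[re1]; split=> //.
  by rewrite -[LHS]RRe_real ?re1// ger0_real// (functional1_ge0 sB pf).
by split; [exact: pf.1|exact: pf.2|rewrite (functional_normE sB pf) f1].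
Qed.

Lemma star_subalgebraT : star_subalgebra [set: A].
Proof. by split=> //; exact: closedT. Qed.

(** This is nonnegativity of the variance [f ((a - f a)^2)]. *)
Lemma state_sq_le (B : set A) (f : A -> R[i]) a : star_subalgebra B ->
  state_on B f -> B a -> star a = a -> f a ^+ 2 <= f (a * a).
Proof.
move=> sB /(state_onE _ sB)[pf f1] Ba sa.
have fr := functional_real sB pf Ba sa.
have B1 := star_subalgebra1 sB.
have Baa := star_subalgebraM sB Ba Ba.
have BZ c b : B b -> B (c *: b) by exact: star_subalgebraZ.
have BB x y : B x -> B y -> B (x - y) by exact: star_subalgebraB.
have BD x y : B x -> B y -> B (x + y) by exact: star_subalgebraD.
set t := f a in fr *.
have : 0 <= f (star (a - t *: 1) * (a - t *: 1)) by apply: pf.2; auto.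
have -> : star (a - t *: 1) * (a - t *: 1) =
    (a * a - t *: a) - (t *: a - t ^+ 2 *: 1).
  rewrite cstarB sa starZ cstar1 (CrealP fr) mulrBr !mulrBl -!scalerAl
    -!scalerAr.
  by rewrite !mulr1 !mul1r scalerA.
rewrite (functionalB sB pf); [|auto..]; rewrite 2?(functionalB sB pf);
  [|auto..].
rewrite 2?(functionalZ sB pf); [|auto..];
  rewrite f1 mulr1 -/t -expr2 subrr subr0.
by rewrite subr_ge0.
Qed.

End PositiveFunctionals.

(** * Existence and extension of states *)

Section StateExistence.
Variables (R : realType) (A : cstarAlgType R).
Implicit Types (a b x y : A).

Lemma nonneg_scalar_ge0 (s : R) : cstar_nonneg (s%:C *: 1 : A) -> 0 <= s.
Proof.
move=> h; rewrite leNgt; apply/negP => s0.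
have hN : cstar_nonneg (- (s%:C *: 1 : A)).
  by rewrite -scaleNr -rmorphN; apply: nonneg_scalar;
    rewrite (lecR 0) oppr_ge0 ltW.
have /eqP := nonneg_anti h hN.
rewrite scaler_eq0 oner_eq0 orbF (inj_eq (@complexI R) s 0) => /eqP s0'.
by rewrite s0' ltxx in s0.
Qed.

(* The graph G prescribes 2 Re phi. *)
Lemma state_extension (G : set (A * R)) :
  G (0, 0) ->
  (forall (c : R) x r y s, G (x, r) -> G (y, s) -> G (c%:C *: x + y, c * r +
    s)) ->
  (forall x r s, G (x, r) -> cstar_nonneg (s%:C *: 1 - (x + star x)) -> r <= s)
    ->
  exists2 phi : A -> R[i], state_on setT phi &
    forall x r, G (x, r) -> phi x + (phi x)^*%R = r%:C.
Proof.
move=> G0 Glin Gdom.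
(* This is the epigraph of the spectral maximum of [x + star x]. *)
pose D (x : realification A) (s : R) :=
  cstar_nonneg (s%:C *: 1 - ((x : A) + star (x : A))).
have D0 : D 0 0.
  by rewrite /D cstar0 addr0 subr0 scale0r; exact: nonneg0.
have DD (x y : realification A) s t : D x s -> D y t -> D (x + y) (s + t).
  move=> hx hy; rewrite /D.
  have -> : (s + t)%:C *: 1 - ((x + y : A) + star (x + y : A)) =
      (s%:C *: 1 - ((x : A) + star (x : A)))
      + (t%:C *: 1 - ((y : A) + star (y : A))).
    by rewrite rmorphD scalerDl starD (addrACA (x : A)) opprD addrACA.
  exact: nonnegD.
have DZ (c : R) (x : realification A) s : 0 < c -> D x s -> D (c *: x) (c * s).
  move=> c0 /(@nonnegZ _ _ c%:C); rewrite (lecR 0) => /(_ (ltW c0)).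
  rewrite /D realification_scaleE starZ rmorphM -scalerA.
  by rewrite geC0_conj ?(lecR 0) ?ltW// scalerBr scalerDr.
have Dex (x : realification A) : exists s, D x s.
  have [k k0 kx] := norm_real_complex ((x : A) + star (x : A)).
  exists k; apply: norm_nonnegB; last by rewrite kx.
  by rewrite starD starK addrC.
have [g [glin gD gG]] := hahn_banach_epigraph D0 DD DZ Dex G0 Glin Gdom.
have gadd x y : g (x + y) = g x + g y.
  by rewrite -[x in LHS]scale1r glin mul1r.
have g0 : g 0 = 0 by apply: (addrI (g 0)); rewrite -gadd !addr0.
have gscale (c : R) (x : A) : g (c%:C *: x) = c * g x.
  by have := glin c x 0; rewrite g0 !addr0.
have gopp x : g (- x) = - g x.
  by apply: (addrI (g x)); rewrite -gadd !subrr.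
(* Both [x] and [- x] have majorant 0, so [g] depends only on the self-adjoint part. *)
have g_antisa (x : A) : x + star x = 0 -> g x = 0.
  move=> sx; apply/le_anti/andP; split.
    by apply: gD; rewrite /D sx scale0r subr0; exact: nonneg0.
  rewrite -oppr_le0 -gopp; apply: gD; rewrite /D cstarN -opprD sx.
  by rewrite scale0r oppr0 subr0; exact: nonneg0.
have g1 : g (1 : A) = 2.
  apply/le_anti/andP; split.
    apply: gD; rewrite /D cstar1 rmorph_nat scaler_nat mulr2n subrr.
    exact: nonneg0.
  rewrite -[leLHS]opprK -[leRHS]opprK lerN2 -gopp; apply: gD.
  rewrite /D rmorphN rmorph_nat scaleNr scaler_nat cstarN cstar1 -(opprD (1 :
    A)) opprK.
  by rewrite mulr2n addNr; exact: nonneg0.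
(* The complex-linear functional whose real part is [g / 2]. *)
pose phi (x : A) : R[i] := 2^-1 * ((g x)%:C - 'i * (g ('i *: x))%:C).
have phi_sa (x : A) : star x = x -> phi x = 2^-1 * (g x)%:C.
  move=> sx; rewrite /phi (g_antisa ('i *: x)) ?mulr0 ?subr0//.
  by rewrite starZ sx conjCi scaleNr subrr.
have g_pos (x : A) : cstar_nonneg x -> 0 <= g x.
  move=> px; rewrite -oppr_le0 -gopp; apply: gD.
  rewrite /D scale0r sub0r cstarN (nonneg_sa px) -opprD opprK.
  exact: nonnegD.
have phi_add x y : phi (x + y) = phi x + phi y.
  by rewrite /phi scalerDr !gadd !rmorphD /=; ring.
have phi_scaleR (r : R) x : phi (r%:C *: x) = r%:C * phi x.
  rewrite /phi gscale scalerA (mulrC 'i r%:C) -scalerA gscale !rmorphM /=; ring.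
have phi_i x : phi ('i *: x) = 'i * phi x.
  rewrite /phi scalerA -(expr2 ('i : R[i])) sqrCi scaleN1r gopp rmorphN /=.
  rewrite mulrCA; congr (_ * _); rewrite mulrBr mulrA -(expr2 ('i : R[i]))
    sqrCi.
  ring.
exists phi.
  apply/(state_onE _ (star_subalgebraT A)); split; last first.
    by rewrite phi_sa ?cstar1// g1 rmorph_nat mulVf// pnatr_eq0.
  split=> [c x y _ _|x _]; last first.
    rewrite phi_sa ?cstarM ?starK// mulr_ge0 ?invr_ge0// (lecR 0).
    exact/g_pos/star_mul_nonneg.
  rewrite phi_add; congr (_ + _).
  rewrite (complexE c) complexiE scalerDl phi_add -scalerA phi_i !phi_scaleR.
  by rewrite [RHS]mulrDl (mulrA 'i).
have conj_real (t : R) : (t%:C)^*%R = t%:C.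
  by apply/CrealP; apply/complex_realP; exists t.
move=> x r /gG gx; rewrite /phi gx rmorphM rmorphB rmorphM fmorphV /=.
rewrite conjCi !conj_real conjC_nat mulNr opprK -mulrDr addrACA addNr addr0.
by rewrite -mulr2n -(mulr_natl r%:C 2) mulKf// pnatr_eq0.
Qed.

(** The functional [l a |-> l |a|] on the real line through [a] is dominated by the spectral maximum
    and extends to a state. *)
Lemma norming_state a : cstar_nonneg a ->
  exists2 phi : A -> R[i], state_on setT phi & phi a = `|a|.
Proof.
move=> pa; have sa := nonneg_sa pa; have [k k0 ka] := norm_real_complex a.
pose G : set (A * R) := [set z | exists l : R, z = (l%:C *: a, 2 * l * k)].
have [||x r s [l [-> ->]]|phi sphi phiG] := @state_extension G.
- by exists 0; rewrite scale0r mulr0 mul0r.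
- move=> c x r y s [l [-> ->]] [m [-> ->]]; exists (c * l + m).
  congr (_, _); last by ring.
  by rewrite rmorphD rmorphM scalerDl scalerA.
- have -> : l%:C *: a + star (l%:C *: a) = (2 * l)%:C *: a.
    rewrite starZ sa (CrealP _); last by apply/complex_realP; exists l.
    by rewrite -scalerDl -rmorphD mulr_natl mulr2n.
  (* For [l >= 0] the norm of [2 l a] is at most [s]. For [l < 0], add [- 2 l (k - a) >= 0] to
     [s - 2 l a >= 0]. *)
  move=> h; have [l0|l0] := leP 0 l.
    have pl : cstar_nonneg ((2 * l)%:C *: a).
      by apply: nonnegZ => //; rewrite (lecR 0) mulr_ge0.
    have s0 : 0 <= s.
      by apply: nonneg_scalar_ge0; rewrite -(subrK ((2 * l)%:C *: a) (_ *: 1));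
        exact: nonnegD.
    have := nonneg_norm_le pl _ h; rewrite (lecR 0) => /(_ s0).
    rewrite normrZ ka ger0_norm ?(lecR 0) ?mulr_ge0//.
    by rewrite -rmorphM lecR.
  rewrite -subr_ge0; apply: nonneg_scalar_ge0.
  have -> : (s - 2 * l * k)%:C *: 1 =
      (s%:C *: 1 - (2 * l)%:C *: a) + (- (2 * l))%:C *: (k%:C *: 1 - a).
    rewrite scalerBr scalerA -rmorphM mulNr (rmorphN _ (2 * l)) scaleNr opprK.
    by rewrite addrA addrAC subrK rmorphB (rmorphN _ (2 * l * k)) scalerDl.
  apply: nonnegD => //; apply: nonnegZ; first by rewrite (lecR 0); lra.
  by apply: norm_nonnegB; rewrite ?ka.
exists phi => //.
have [pphi _] := (state_onE _ (star_subalgebraT A)).1 sphi.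
have pa0 := functional_ge0 (star_subalgebraT A) pphi I pa.
have : G (a, 2 * k) by exists 1; rewrite scale1r mulr1.
move=> /phiG; rewrite geC0_conj// -mulr2n -(mulr_natl (phi a)) rmorphM /=
  rmorph_nat ka.
by apply: mulfI; rewrite pnatr_eq0.
Qed.

Lemma nonneg_sq_le a : cstar_nonneg a -> `|a| <= 1 -> cstar_nonneg (a - a * a).
Proof.
move=> pa a1; have -> : a - a * a = a * (1 - a) by rewrite mulrBr mulr1.
apply: nonneg_mul_comm => //; last by rewrite mulrBr mulrBl mulr1 mul1r.
by rewrite -(scale1r 1); apply: norm_nonnegB => //; exact: nonneg_sa.
Qed.

Section FixedPositive.
Variables (phi : A -> R[i]) (b : A).
Hypotheses (sphi : state_on setT phi) (sb : star b = b).
Hypotheses (phib : phi b = 1) (phibb : phi (b * b) = 1).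

Let pphi := ((state_onE _ (star_subalgebraT A)).1 sphi).1.
Let phi1 := ((state_onE _ (star_subalgebraT A)).1 sphi).2.

(** Since [phi ((1 - b)^2) = 0], Cauchy-Schwarz kills [phi ((1 - b) x)]. *)
Lemma state_fixed_mull x : phi (b * x) = phi x.
Proof.
have nn : phi ((1 - b) * (1 - b)) = 0.
  rewrite mulrBr mulr1 mulrBl mul1r !(functionalB (star_subalgebraT A) pphi)//.
  by rewrite phi1 phib phibb subrr.
have sn : star (1 - b) = 1 - b by rewrite cstarB cstar1 sb.
have := functional_cauchy_schwarz0 (star_subalgebraT A) pphi I (I : setT x) sn
  nn.
rewrite mulrBl mul1r (functionalB (star_subalgebraT A) pphi)// => /eqP.
by rewrite subr_eq0 => /eqP.
Qed.

Lemma state_fixed_mulr x : phi (x * b) = phi x.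
Proof.
rewrite -[x * b]starK (functional_star (star_subalgebraT A) pphi)// cstarM sb.
rewrite state_fixed_mull (functional_star (star_subalgebraT A) pphi)//.
exact: conjCK.
Qed.

End FixedPositive.

(* A state attaining the norm of b a^2 b attains those of a and b. *)
Lemma norming_state_pair a b : cstar_nonneg a -> cstar_nonneg b ->
  `|a| = 1 -> `|b| = 1 -> `|a * b| = 1 ->
  exists phi : A -> R[i], [/\ state_on setT phi, phi a = 1 & phi b = 1].
Proof.
move=> pa pb na nb nab.
have sa := nonneg_sa pa; have sb := nonneg_sa pb.
have [phi sphi phiab] := norming_state (star_mul_nonneg (a * b)).
rewrite cstar_normC nab expr1n in phiab.
have [pphi phi1] := (state_onE _ (star_subalgebraT A)).1 sphi.
have le_norm x : star x = x -> phi x <= `|x|.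
  move=> sx; have := functional_le_norm_sa (star_subalgebraT A) pphi I sx.
  by rewrite phi1 mulr1.
have phi_le x y : cstar_nonneg (y - x) -> phi x <= phi y.
  move=> xy; rewrite -subr_ge0 -(functionalB (star_subalgebraT A) pphi)//.
  exact: (functional_ge0 (star_subalgebraT A)).
have abE : star (a * b) * (a * b) = b * (a * a) * b.
  by rewrite cstarM sa sb !mulrA.
rewrite abE in phiab.
(* [1 = phi (b a^2 b) <= phi (b^2) <= 1], because [b^2 - b a^2 b = star (s b) * (s b)] with
   [s^2 = 1 - a^2]. *)
have phibb : phi (b * b) = 1.
  apply/le_anti/andP; split.
    apply: (le_trans (le_norm _ _)); first by rewrite cstarM sb.
    by apply: (le_trans (cstar_normMle _ _)); rewrite nb mulr1.
  rewrite -phiab; apply: phi_le.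
  have paa : cstar_nonneg (1 - a * a).
    rewrite -(scale1r 1); apply: norm_nonnegB; first by rewrite cstarM sa.
    by apply: (le_trans (cstar_normMle _ _)); rewrite na mulr1.
  have [s [ps ss _ _]] := nonneg_sqrt paa.
  have -> : b * b - b * (a * a) * b = star (s * b) * (s * b).
    by rewrite cstarM sb (nonneg_sa ps) [RHS]mulrA -(mulrA b s s) ss mulrBr
      mulr1 mulrBl.
  exact: star_mul_nonneg.
have phib : phi b = 1.
  apply/le_anti/andP; split; first by rewrite -nb; exact: le_norm.
  by rewrite -phibb; apply/phi_le/nonneg_sq_le; rewrite ?nb.
(* Factors [b] on either side do not change [phi], so [phi (a^2) = phi (b a^2 b)]. *)
have phiaa : phi (a * a) = 1.
  by rewrite -phiab (state_fixed_mulr sphi sb)// (state_fixed_mull sphi sb).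
exists phi; split=> //.
apply/le_anti/andP; split; first by rewrite -na; exact: le_norm.
by rewrite -phiaa; apply/phi_le/nonneg_sq_le; rewrite ?na.
Qed.

(** [G] is the graph of [2 Re (phi1 a + phi2 b)] at [a + b]; domination also settles its
    independence of the decomposition. *)
Lemma joint_state (B1 B2 : set A) (phi1 phi2 : A -> R[i]) :
  star_subalgebra B1 -> star_subalgebra B2 ->
  (forall a b, B1 a -> B2 b -> `|a * b| = `|a| * `|b|) ->
  state_on B1 phi1 -> state_on B2 phi2 ->
  exists phi : A -> R[i], [/\ state_on setT phi,
    forall a, B1 a -> cstar_nonneg a -> phi a = phi1 a &
    forall b, B2 b -> cstar_nonneg b -> phi b = phi2 b].
Proof.
move=> sB1 sB2 B12 /(state_onE _ sB1)[p1 phi11] /(state_onE _ sB2)[p2 phi21].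
pose G : set (A * R) := [set z | exists a b, [/\ B1 a, B2 b, z.1 = a + b &
  z.2%:C = phi1 (a + star a) + phi2 (b + star b)]].
have [||x r s /=|phi sphi phiG] := @state_extension G.
- exists 0, 0; split; [exact: star_subalgebra0|exact: star_subalgebra0| |] =>
  /=.
    by rewrite addr0.
  by rewrite cstar0 addr0 (functional0 sB1)// (functional0 sB2)// addr0.
- move=> c x r y s [a [b [/= Ba Bb -> rE]]] [a' [b' [/= Ba' Bb' -> sE]]].
  have lin (B : set A) (f : A -> R[i]) v v' : star_subalgebra B ->
      positive_functional B f -> B v -> B v' ->
      f (c%:C *: v + v' + star (c%:C *: v + v')) =
      c%:C * f (v + star v) + f (v' + star v').
    move=> sB pf Bv Bv'; rewrite starD starZ (CrealP _); last first.
      by apply/complex_realP; exists c.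
    rewrite addrACA -scalerDr pf.1//.
      by apply: (star_subalgebraD sB) => //; exact: star_subalgebra_star.
    by apply: (star_subalgebraD sB) => //; exact: star_subalgebra_star.
  exists (c%:C *: a + a'), (c%:C *: b + b'); split=> /=.
  + by apply: (star_subalgebraD sB1) => //; exact: star_subalgebraZ.
  + by apply: (star_subalgebraD sB2) => //; exact: star_subalgebraZ.
  + by rewrite scalerDr addrACA.
  + rewrite rmorphD rmorphM /= rE sE (lin _ _ _ _ sB1 p1)// (lin _ _ _ _ sB2
    p2)//.
    ring.
- move=> [a [b [/= Ba Bb -> rE]]]; rewrite starD addrACA.
  set a' := a + star a in rE *; set b' := b + star b in rE *.
  have Ba' : B1 a' by apply: (star_subalgebraD sB1) => //;
    exact: star_subalgebra_star.
  have Bb' : B2 b' by apply: (star_subalgebraD sB2) => //;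
    exact: star_subalgebra_star.
  have sa' : star a' = a' by rewrite starD starK addrC.
  have sb' : star b' = b' by rewrite starD starK addrC.
  clearbody a' b' => h.
  (* A scalar shift makes [v] nonnegative; [k + 1] instead of [k] keeps the result nonzero, so that
     it can be normalized. *)
  have shift (B : set A) (v : A) : star_subalgebra B -> B v -> star v = v ->
      exists t : R, [/\ B (t%:C *: 1 + v), cstar_nonneg (t%:C *: 1 + v)
                      & t%:C *: 1 + v != 0].
    move=> sB Bv sv; have [k k0 kv] := norm_real_complex v.
    exists (k + 1); split.
    - apply: (star_subalgebraD sB) => //; apply: (star_subalgebraZ sB).
      exact: star_subalgebra1.
    - rewrite -[v in _ + v]opprK; apply: norm_nonnegB.
        by rewrite cstarN sv.
      by rewrite normrN kv lecR lerDl.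
    - apply: contra_eqN kv => /eqP/(canRL (addKr _)); rewrite addr0 => ->.
      rewrite normrN normrZ cstar_norm1 mulr1 ger0_norm ?(lecR 0) ?addr_ge0//.
      by rewrite (inj_eq (@complexI R)) -subr_eq0 addrC addKr oner_eq0.
  have [t [Bat pat at0]] := shift _ _ sB1 Ba' sa'.
  have [u [Bbu pbu bu0]] := shift _ _ sB2 Bb' sb'.
  set at1 := t%:C *: 1 + a' in Bat pat at0.
  set bu1 := u%:C *: 1 + b' in Bbu pbu bu0.
  have nat0 : 0 < `|at1| by rewrite normr_gt0.
  have nbu0 : 0 < `|bu1| by rewrite normr_gt0.
  have unit (v : A) : v != 0 -> `| `|v|^-1 *: v| = 1.
    by move=> v0; rewrite normrZ normfV normr_id mulVf// normr_eq0.
  have [psi [spsi psia psib]] : exists psi : A -> R[i],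
      [/\ state_on setT psi, psi (`|at1|^-1 *: at1) = 1 & psi (`|bu1|^-1 *:
        bu1) = 1].
    apply: norming_state_pair; rewrite ?unit//.
    + by apply: nonnegZ; rewrite ?invr_ge0.
    + by apply: nonnegZ; rewrite ?invr_ge0.
    + rewrite B12 ?unit ?mulr1//.
        exact: star_subalgebraZ.
      exact: star_subalgebraZ.
  have [ppsi psi1] := (state_onE _ (star_subalgebraT A)).1 spsi.
  have sT := star_subalgebraT A.
  rewrite (functionalZ sT ppsi)// in psia;
    rewrite (functionalZ sT ppsi)// in psib.
  have {}psia : psi at1 = `|at1|.
    by rewrite -[RHS]mulr1 -psia mulVKf// gt_eqF.
  have {}psib : psi bu1 = `|bu1|.
    by rewrite -[RHS]mulr1 -psib mulVKf// gt_eqF.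
  (* [psi] attains the norms bounding [phi1] and [phi2]. All three are 1 at the unit, so the shifts
     cancel and [phi1 a' + phi2 b' <= psi (a' + b') <= s]. *)
  have phia : phi1 at1 <= psi at1.
    rewrite psia; have := functional_le_norm_sa sB1 p1 Bat (nonneg_sa pat).
    by rewrite phi11 mulr1.
  have phib : phi2 bu1 <= psi bu1.
    rewrite psib; have := functional_le_norm_sa sB2 p2 Bbu (nonneg_sa pbu).
    by rewrite phi21 mulr1.
  have := functional_ge0 sT ppsi I h.
  rewrite (functionalB sT ppsi)// (functionalD ppsi)// (functionalZ sT ppsi)//.
  rewrite psi1 mulr1 subr_ge0 -lecR rE; apply: le_trans.
  move: phia phib; rewrite /at1 /bu1.
  rewrite !(functionalD ppsi)// !(functionalZ sT ppsi)// psi1.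
  have B11 := star_subalgebra1 sB1; have B21 := star_subalgebra1 sB2.
  have Bt1 : B1 (t%:C *: 1) by exact: star_subalgebraZ.
  have Bu1 : B2 (u%:C *: 1) by exact: star_subalgebraZ.
  rewrite (functionalD p1)// (functionalD p2)//.
  rewrite (functionalZ sB1 p1)// (functionalZ sB2 p2)//.
  by rewrite phi11 phi21 !lerD2l; exact: lerD.
have [pphi phi_1] := (state_onE _ (star_subalgebraT A)).1 sphi.
have n2 : (2 : R[i]) != 0 by rewrite pnatr_eq0.
exists phi; split=> // v Bv pv.
  have pv0 := functional_ge0 sB1 p1 Bv pv.
  have [r rE] : exists r : R, phi1 v = r%:C by apply/complex_realP/ger0_real.
  (* Both [phi v] and [phi1 v] are real, so prescribing twice the real part fixes [phi v]. *)
  have : G (v, 2 * r).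
    exists v, 0; split=> //=; [exact: star_subalgebra0|by rewrite addr0|].
    rewrite cstar0 addr0 (functional0 sB2)// addr0 (nonneg_sa pv).
    by rewrite (functionalD p1)// rE mulr_natl mulr2n rmorphD.
  move=> /phiG; rewrite geC0_conj; last exact: (functional_ge0
    (star_subalgebraT A)).
  by rewrite -mulr2n -(mulr_natl (phi v)) rmorphM /= rmorph_nat -rE;
    exact: mulfI.
have pv0 := functional_ge0 sB2 p2 Bv pv.
have [r rE] : exists r : R, phi2 v = r%:C by apply/complex_realP/ger0_real.
have : G (v, 2 * r).
  exists 0, v; split=> //=; [exact: star_subalgebra0|by rewrite add0r|].
  rewrite cstar0 addr0 (functional0 sB1)// add0r (nonneg_sa pv).
  by rewrite (functionalD p2)// rE mulr_natl mulr2n rmorphD.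
move=> /phiG; rewrite geC0_conj; last exact: (functional_ge0 (star_subalgebraT
  A)).
by rewrite -mulr2n -(mulr_natl (phi v)) rmorphM /= rmorph_nat -rE; exact: mulfI.
Qed.

End StateExistence.

(** * Ternary subspaces containing a unit vector *)

Section InnerSpan.
Variables (R : realType) (A : cstarAlgType R) (E : hilbertModType A).
Implicit Types (x y z : E) (a b : A) (F : set E).

Lemma inner_ractl x y a : inner (ract x a) y = star a * inner x y.
Proof. by rewrite -inner_star inner_ract cstarM inner_star. Qed.

(** [inner x x] has a positive root, so the choice in [cstar_sqrt] does not fall back on 0. *)
Lemma modulusP x : cstar_nonneg (modulus x) /\ modulus x ^+ 2 = inner x x.
Proof.
have /positive_nonneg px := inner_positive x.
have [r [pr rr _ _]] := nonneg_sqrt px.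
have [] : [set b | cstar_positive b /\ b ^+ 2 = inner x x] (modulus x).
  apply: xgetPex; exists r; split; first exact/positive_nonneg.
  by rewrite expr2.
by move=> /positive_nonneg.
Qed.

Lemma closed_span_subspace (V : normedModType R[i]) (S : set V) :
  closed_subspace (closed_span S).
Proof.
split; last by apply: closed_bigI => X [[_ cX] _].
split=> [|c u v]; rewrite !inE.
  by move=> X [[[X0 _] _] _]; move: X0; rewrite inE.
move=> Su Sv X CX; have Xu := Su _ CX; have Xv := Sv _ CX.
case: CX => [[[_ Xlin] _] _].
by have := Xlin c u v; rewrite !inE; apply.
Qed.

Lemma closed_subspaceD (V : normedModType R[i]) (S : set V) u v :
  closed_subspace S -> S u -> S v -> S (u + v).
Proof.
move=> [[_ Slin] _] Su Sv.
by have := Slin 1 u v; rewrite !inE scale1r; apply.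
Qed.

Lemma closed_subspaceZ (V : normedModType R[i]) (S : set V) c u :
  closed_subspace S -> S u -> S (c *: u).
Proof.
move=> [[S0 Slin] _] Su; rewrite inE in S0.
by have := Slin c u 0; rewrite !inE addr0; apply.
Qed.

Lemma inner_span_inner F x y : F x -> F y -> inner_span F (inner x y).
Proof. by move=> Fx Fy X [_]; apply; exists (x, y). Qed.

Section UnitVector.
Variables (F : set E) (z : E).
Hypotheses (tF : ternary_subspace F) (Fz : F z) (zz : inner z z = 1).

(** Thanks to [<z, z> = 1], [star a * b] is the single inner product [<z.a, z.b>], and ternarity
    puts both vectors in [F]. *)
Lemma inner_span_star_mul a b :
  inner_span F a -> inner_span F b -> inner_span F (star a * b).
Proof.
move=> Ba Bb; have -> : star a * b = inner (ract z a) (ract z b).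
  by rewrite inner_ract inner_ractl zz mulr1.
by apply: inner_span_inner; apply: tF.2.
Qed.

Lemma inner_span_subalgebra : star_subalgebra (inner_span F).
Proof.
have cB : closed_subspace (inner_span F) by exact: closed_span_subspace.
have B1 : inner_span F 1 by rewrite -zz; exact: inner_span_inner.
have Bs a : inner_span F a -> inner_span F (star a).
  by move=> Ba; rewrite -[star a]mulr1; exact: inner_span_star_mul.
split=> //; first exact: cB.2.
- by move=> a b; exact: closed_subspaceD.
- by move=> c a; exact: closed_subspaceZ.
- by move=> a b Ba Bb; rewrite -(starK a); apply: inner_span_star_mul => //;
  exact: Bs.
Qed.

(** By uniqueness the modulus is the constructed root, which stays in any closed unital
    star-subalgebra containing [<x, x>]. *)
Lemma modulus_inner_span x : F x -> inner_span F (modulus x).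
Proof.
move=> Fx; have [pm mm] := modulusP x.
have /positive_nonneg px := inner_positive x.
have [r [pr rr _ rB]] := nonneg_sqrt px.
have -> : modulus x = r by apply: nonneg_sqrt_unique; rewrite // rr -mm expr2.
apply: (rB (inner_span F)); last exact: inner_span_inner.
exact: inner_span_subalgebra.
Qed.

(** Makes every nonnegative element of [<F, F>] the modulus of a vector of [F]. *)
Lemma modulus_ract a : cstar_nonneg a -> modulus (ract z a) = a.
Proof.
move=> pa; have [pm mm] := modulusP (ract z a).
apply: nonneg_sqrt_unique => //.
by rewrite -expr2 mm inner_ract inner_ractl zz mulr1 (nonneg_sa pa).
Qed.

End UnitVector.
End InnerSpan.

(** * States determined by the upper bound *)

Section UpperBound.
Variables (R : realType) (A : cstarAlgType R).
Implicit Types (a b p : A).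

Lemma state_on_sub (B : set A) (phi : A -> R[i]) :
  star_subalgebra B -> state_on setT phi -> state_on B phi.
Proof.
move=> sB /(state_onE _ (star_subalgebraT A))[[lin pos] phi1].
apply/(state_onE _ sB); split=> //; split=> [c a b _ _|a _].
  by apply: lin.
by apply: pos.
Qed.

(* The upper bound kills phi (1 - p), because phi1 ((1 - p)^2) = 0. *)
Lemma state_upper_bound_fix (B : set A) (phi phi1 : A -> R[i]) (M : R) p :
  star_subalgebra B -> state_on setT phi -> state_on B phi1 -> B p ->
  cstar_nonneg p -> `|p| = 1 -> phi1 p = 1 ->
  (forall c, B c -> cstar_nonneg c -> phi c <= M%:C * sqrtC (phi1 (c ^+ 2))) ->
  phi p = 1 /\ phi (p * p) = 1.
Proof.
move=> sB sphi sphi1 Bp pp np phip bound.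
have sT := star_subalgebraT A.
have [pphi phi_1] := (state_onE _ sT).1 sphi.
have [pphi1 phi1_1] := (state_onE _ sB).1 sphi1.
have sp := nonneg_sa pp; have B1 := star_subalgebra1 sB.
have spp : star (p * p) = p * p by rewrite cstarM sp.
have npp : `|p * p| <= 1 by apply: (le_trans (cstar_normMle _ _));
  rewrite np mulr1.
have Bpp : B (p * p) by exact: star_subalgebraM.
have Bc : B (1 - p) by exact: star_subalgebraB.
have pc : cstar_nonneg (1 - p).
  by rewrite -(scale1r 1); apply: norm_nonnegB; rewrite ?np.
(* The value is [phi1 (p^2) - 1], which is nonpositive since [|p^2| <= 1]. *)
have phi1c : phi1 ((1 - p) ^+ 2) = 0.
  apply/le_anti/andP; split; last first.
    by rewrite expr2 -{1}(nonneg_sa pc); exact: pphi1.2.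
  rewrite expr2 mulrBr mulr1 mulrBl mul1r (functionalB sB pphi1)//; last first.
    exact: star_subalgebraB.
  rewrite !(functionalB sB pphi1)// phi1_1 phip subrr sub0r opprB subr_le0.
  apply: (le_trans (functional_le_norm_sa sB pphi1 Bpp spp)).
  by rewrite phi1_1 mulr1.
have phic : phi (1 - p) = 0.
  apply/le_anti/andP; split; last exact: (functional_ge0 sT pphi).
  by apply: (le_trans (bound _ Bc pc)); rewrite phi1c sqrtC0 mulr0.
have phip1 : phi p = 1.
  move: phic; rewrite (functionalB sT pphi)// phi_1 => /eqP.
  by rewrite subr_eq0 => /eqP <-.
split=> //; apply/le_anti/andP; split.
  apply: (le_trans (functional_le_norm_sa sT pphi I spp)).
  by rewrite phi_1 mulr1.
by have := state_sq_le sT sphi I sp; rewrite phip1 expr1n.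
Qed.

Lemma norm_star_mul_eq1 a : `|a| = 1 -> `|star a * a| = 1.
Proof. by rewrite cstar_normC => ->; rewrite expr1n. Qed.

End UpperBound.

Theorem corollary4p2 (R : realType) (A : cstarAlgType R) (E : hilbertModType A)
    (E1 E2 : set E) (z0 : E)
    (tE1 : ternary_subspace E1) (tE2 : ternary_subspace E2)
    (z0E : (E1 `&` E2) z0) (z01 : inner z0 z0 = 1) :
  module_independent E1 E2 <->
  (forall x y : E, E1 x -> E2 y ->
     `|inner x z0 * inner y z0| = `|inner x z0| * `|inner y z0|).
Proof.
have [E1z E2z] := z0E.
have sB1 := inner_span_subalgebra tE1 E1z z01.
have sB2 := inner_span_subalgebra tE2 E2z z01.
have sT := star_subalgebraT A.
split=> [[m [M [_ M0 indep]]] x y E1x E2y|normM].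
  (* One inequality is submultiplicativity; the other reduces by scaling to elements of norm 1. *)
  suff unit_case a b : inner_span E1 a -> inner_span E2 b ->
      `|a| = 1 -> `|b| = 1 -> 1 <= `|a * b|.
    have Ba : inner_span E1 (inner x z0) by exact: inner_span_inner.
    have Bb : inner_span E2 (inner y z0) by exact: inner_span_inner.
    apply/le_anti; rewrite cstar_normMle /=.
    set a := inner x z0 in Ba *; set b := inner y z0 in Bb *.
    have [->|a0] := eqVneq a 0; first by rewrite normr0 mul0r.
    have [->|b0] := eqVneq b 0; first by rewrite normr0 mulr0.
    have na0 : 0 < `|a| by rewrite normr_gt0.
    have nb0 : 0 < `|b| by rewrite normr_gt0.
    have := unit_case (`|a|^-1 *: a) (`|b|^-1 *: b).
    rewrite -scalerAl -scalerAr scalerA -invfM 3!normrZ.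
    rewrite !ger0_norm ?invr_ge0 ?mulr_ge0// !mulVf ?gt_eqF//.
    rewrite ler_pdivlMl ?mulr_gt0// mulr1; apply=> //.
      exact: (star_subalgebraZ sB1).
    exact: (star_subalgebraZ sB2).
  move=> {x y E1x E2y} Ba Bb na nb.
  have Bp : inner_span E1 (star a * a).
    by apply: (star_subalgebraM sB1) => //; exact: (star_subalgebra_star sB1).
  have Bq : inner_span E2 (b * star b).
    by apply: (star_subalgebraM sB2) => //; exact: (star_subalgebra_star sB2).
  set p := star a * a in Bp; set q := b * star b in Bq.
  have pp : cstar_nonneg p by exact: star_mul_nonneg.
  have pq : cstar_nonneg q by rewrite /q -{1}(starK b); exact: star_mul_nonneg.
  have np : `|p| = 1 by exact: norm_star_mul_eq1.
  have nq : `|q| = 1.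
    by rewrite /q -{1}(starK b); apply: norm_star_mul_eq1;
      rewrite cstar_norm_star.
  have [phi1 sphi1 phi1p] := norming_state pp.
  have [phi2 sphi2 phi2q] := norming_state pq.
  rewrite np in phi1p; rewrite nq in phi2q.
  have st1 := state_on_sub sB1 sphi1; have st2 := state_on_sub sB2 sphi2.
  have [phi [sphi bound1 bound2]] := indep _ _ st1 st2.
  (* The vector [z0.c] lies in [E1] and has modulus [c], so the bound on moduli reaches every
     nonnegative [c]. *)
  have [phip phipp] : phi p = 1 /\ phi (p * p) = 1.
    apply: (@state_upper_bound_fix _ _ _ phi phi1 M p sB1) => // c Bc pc.
    have /andP[_] := bound1 (ract z0 c) (tE1.2 _ _ E1z Bc).
    by rewrite (modulus_ract z01 pc).
  have [phiq _] : phi q = 1 /\ phi (q * q) = 1.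
    apply: (@state_upper_bound_fix _ _ _ phi phi2 M q sB2) => // c Bc pc.
    have /andP[_] := bound2 (ract z0 c) (tE2.2 _ _ E2z Bc).
    by rewrite (modulus_ract z01 pc).
  have phipq : phi (p * q) = 1.
    by rewrite (state_fixed_mull sphi (nonneg_sa pp)).
  have [pphi phi_1] := (state_onE _ sT).1 sphi.
  have : `|phi (p * q)| <= `|p * q|.
    by have := functional_norm_le sT pphi (I : setT (p * q));
      rewrite phi_1 mulr1.
  rewrite phipq normr1 => /le_trans; apply.
  (* The outer factors have norm 1, so [|p q| <= |a b|]. *)
  have -> : p * q = star a * (a * b) * star b by rewrite /p /q !mulrA.
  apply: (le_trans (cstar_normMle _ _)); rewrite cstar_norm_star nb mulr1.
  by apply: (le_trans (cstar_normMle _ _)); rewrite cstar_norm_star na mul1r.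
have B12 a b : inner_span E1 a -> inner_span E2 b -> `|a * b| = `|a| * `|b|.
  move=> Ba Bb.
  (* Every [c] is [<z0.(star c), z0>], so the hypothesis covers both whole algebras. *)
  have innE (c : A) : c = inner (ract z0 (star c)) z0.
    by rewrite inner_ractl starK z01 mulr1.
  rewrite (innE a) (innE b); apply: normM.
    by apply: tE1.2 => //; exact: (star_subalgebra_star sB1).
  by apply: tE2.2 => //; exact: (star_subalgebra_star sB2).
exists 1, 1; split=> // phi1 phi2 st1 st2.
have [phi [sphi phiE1 phiE2]] := joint_state sB1 sB2 B12 st1 st2.
have bound (B : set A) (f : A -> R[i]) r : star_subalgebra B -> state_on B f ->
    B r -> cstar_nonneg r -> phi r = f r ->
    1%:C * f r <= phi r <= 1%:C * sqrtC (f (r ^+ 2)).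
  move=> sB sf Br pr ->; rewrite rmorph1 !mul1r lexx /=.
  have fr0 : 0 <= f r.
    by have [pf _] := (state_onE _ sB).1 sf; exact: (functional_ge0 sB pf).
  (* [f r] is the square root of [(f r)^2 <= f (r^2)]. *)
  rewrite -{1}(sqrCK fr0) ler_sqrtC ?qualifE/= ?exprn_ge0//.
    by rewrite expr2; exact: (state_sq_le sB sf Br (nonneg_sa pr)).
  have [pf _] := (state_onE _ sB).1 sf.
  by rewrite expr2 -{1}(nonneg_sa pr); exact: pf.2.
exists phi; split=> // x Ex; have [pm _] := modulusP x.
  have Bm := modulus_inner_span tE1 E1z z01 Ex.
  by apply: (bound _ _ _ sB1) => //; exact: phiE1.
have Bm := modulus_inner_span tE2 E2z z01 Ex.
by apply: (bound _ _ _ sB2) => //; exact: phiE2.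
Qed.
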